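(* Let $n\ge 1$. The Temperley-Lieb elements of the torus braids $\beta_{m,n}$ with $m$ full clockwise rotations, suitably normalized, converge as $m\to+\infty$ to the Jones-Wenzl projector in $\mathrm{TL}^+_n$: $$\lim_{m\rightarrow+\infty} q^{\frac12 mn(n-1)}\,\langle \beta_{m,n}\rangle = P_n^+ .$$
   Context: Temperley-Lieb tangles. A Temperley-Lieb (TL) $(k,l)$-tangle is a planar crossingless matching, up to isotopy, of $k$ bottom and $l$ top boundary points, without closed circles. Composition $\tau_1\circ\tau_2$ is stacking ($\tau_1$ on top of $\tau_2$). Algebra. $\mathrm{TL}_n$ is the Temperley-Lieb algebra over $\mathbb{Z}[q,q^{-1}]$ (a half-integer power of $q$ is allowed as a common factor): it is the free module on the TL $(n,n)$-tangles $\lambda$, with product given by composition, where every closed circle is removed and replaced by the factor $-(q+q^{-1})$. Modules $\mathrm{TL}_{k,l}$ are defined in the same way from TL $(k,l)$-tangles. For $1\le i\le n-1$, $\mathrm{cap}_i$ is the TL $(n,n-2)$-tangle joining bottom points $i,i+1$ by an arc, with all other strands vertical; $\mathrm{cup}_i$ is its mirror image, an $(n-2,n)$-tangle; $U_i=\mathrm{cup}_i\circ\mathrm{cap}_i$. $\mathrm{TL}_n^{\mathbb{Q}}$ and $\mathrm{TL}_n^+$ are the same algebras over $\mathbb{Q}(q)$ and over the Laurent power series in $q$ (finitely many negative powers of $q$), respectively. Projector. $P_n\in \mathrm{TL}_n^{\mathbb{Q}}$, the Jones-Wenzl projector, is the unique non-trivial idempotent with $\mathrm{cap}_i\circ P_n=0$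 for $1\le i\le n-1$. $P_n^+\in\mathrm{TL}^+_n$ is obtained from $P_n$ by expanding its coefficients as Laurent series in powers of $q$. Braids. The elementary negative braid $\sigma_i$ ($1\le i\le n-1$) has Kauffman bracket $\langle\sigma_i\rangle=q^{1/2}U_i+q^{-1/2}\,\mathrm{id}_n$, and the bracket $\langle\,\cdot\,\rangle$ is multiplicative under composition. The torus braid with $m$ full clockwise rotations of $n$ strands is $\beta_{m,n}=(\sigma_1\sigma_2\cdots\sigma_{n-1})^{mn}$ (it has $mn(n-1)$ crossings). Limits. For $\alpha\in\mathrm{TL}_n^+$ write $\alpha=O_+(q^m)$ if $\alpha=\sum_\lambda\sum_{j\ge m}a_{\lambda,j}q^j\lambda$, and put $|\alpha|_q=\sup\{m:\alpha=O_+(q^m)\}$. A sequence $\alpha_1,\alpha_2,\ldots\in\mathrm{TL}_n^+$ has limit $\beta$, written $\lim_{k\to\infty}\alpha_k=\beta$, if $\lim_{k\to\infty}|\beta-\alpha_k|_q=+\infty$. *)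

(* Defs.v *)
From HB Require Import structures.
From mathcomp Require Import all_boot all_order all_algebra.
From mathcomp Require Import boolp classical_sets functions cardinality fsbigop.
From mathcomp Require Import filter constructive_ereal.
From mathcomp Require Import zify.

Set Implicit Arguments.
Unset Strict Implicit.
Unset Printing Implicit Defensive.

Import Order.TTheory GRing.Theory Num.Theory.

Local Open Scope ring_scope.

Section Laurent.
Variable F : fieldType.

Record laurent := MkLaurent {
  lcoef :> int -> F;
  lcoef_bounded : exists N : int, forall j, j < N -> lcoef j = 0 }.

HB.instance Definition _ := gen_eqMixin laurent.
HB.instance Definition _ := gen_choiceMixin laurent.

Implicit Types f g h : laurent.

Lemma laurentP f g : (forall j, f j = g j) -> f = g.
Proof.
case: f g => f bf [g bg] /= /funext fg; case: _ / fg bg => bg.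
by congr MkLaurent; apply: Prop_irrelevance.
Qed.

Fact lzero_bounded : exists N : int, forall j, j < N -> (fun=> 0 : F) j = 0.
Proof. by exists 0. Qed.
Definition lzero := MkLaurent lzero_bounded.

Fact ladd_bounded f g : exists N : int, forall j, j < N -> f j + g j = 0.
Proof.
have [N fN] := lcoef_bounded f; have [M gM] := lcoef_bounded g.
exists (Order.min N M) => j; rewrite lt_min => /andP[jN jM].
by rewrite fN // gM // addr0.
Qed.
Definition ladd f g := MkLaurent (ladd_bounded f g).

Fact lopp_bounded f : exists N : int, forall j, j < N -> - f j = 0.
Proof.
by have [N fN] := lcoef_bounded f; exists N => j jN; rewrite fN ?oppr0.
Qed.
Definition lopp f := MkLaurent (lopp_bounded f).

Fact lmonom_bounded (i : int) :
  exists N : int, forall j, j < N -> (j == i)%:R = 0 :> F.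
Proof. by exists i => j ji; rewrite lt_eqF. Qed.
Definition lmonom i := MkLaurent (lmonom_bounded i).

(* Only finitely many terms are nonzero, as f and g are bounded below. *)
Definition lmul_coef f g (k : int) : F :=
  \sum_(i \in [set: int]) f i * g (k - i).

Lemma lmul_window f g (k a : int) (L : nat) :
  (forall i, i < a -> f i = 0) ->
  (forall i, i <= k - a - L%:Z -> g i = 0) ->
  lmul_coef f g k = \sum_(i < L) f (a + i%:Z) * g (k - a - i%:Z).
Proof.
move=> fa gL; rewrite /lmul_coef.
rewrite (@fsbigE _ _ _ _ _ [seq a + i%:Z | i <- iota 0 L]) //; last 2 first.
- by rewrite map_inj_uniq ?iota_uniq// => i j; lia.
- move=> i _ iN; case: (ltP i a) => [/fa ->|ai]; first by rewrite mul0r.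
  rewrite gL ?mulr0//; case: (leP i (k - (k - a - L%:Z) - 1)) => [iL|]; last lia.
  case/negP: iN; apply/mapP; exists `|(i - a)%R|%N; rewrite ?mem_iota; lia.
have -> : iota 0 L = index_iota 0 L by rewrite /index_iota subn0.
rewrite big_map big_mkord.
rewrite big_mkcond; apply: eq_bigr => i _.
by rewrite in_setT opprD addrA.
Qed.

Fact lmul_bounded f g :
  exists N : int, forall j, j < N -> lmul_coef f g j = 0.
Proof.
have [N fN] := lcoef_bounded f; have [M gM] := lcoef_bounded g.
exists (N + M) => j jNM; rewrite (@lmul_window f g j N 0) ?big_ord0//.
by move=> i ij; apply: gM; lia.
Qed.
Definition lmul f g := MkLaurent (lmul_bounded f g).

Lemma laddA : associative ladd.
Proof. by move=> f g h; apply: laurentP => j /=; rewrite addrA. Qed.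
Lemma laddC : commutative ladd.
Proof. by move=> f g; apply: laurentP => j /=; rewrite addrC. Qed.
Lemma ladd0 : left_id lzero ladd.
Proof. by move=> f; apply: laurentP => j /=; rewrite add0r. Qed.
Lemma laddN : left_inverse lzero lopp ladd.
Proof. by move=> f; apply: laurentP => j /=; rewrite addNr. Qed.

HB.instance Definition _ :=
  GRing.isZmodule.Build laurent laddA laddC ladd0 laddN.

Lemma lmulE f g N M (k a : int) (L : nat) :
  (forall i, i < N -> f i = 0) -> (forall i, i < M -> g i = 0) ->
  a <= N -> k - M < a + L%:Z ->
  lmul f g k = \sum_(i < L) f (a + i%:Z) * g (k - a - i%:Z).
Proof.
move=> fN gM aN aL; apply: lmul_window => // i ia; first by apply: fN; lia.
by apply: gM; lia.
Qed.

Lemma lmulC : commutative lmul.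
Proof.
move=> f g; apply: laurentP => k.
have [N fN] := lcoef_bounded f; have [M gM] := lcoef_bounded g.
pose L := `|(k - N - M)%R|%N.+1.
have [kNM|kNM] := ltP k (N + M).
  by rewrite (@lmulE _ _ N M k N 0)// ?(@lmulE _ _ M N k M 0)// ?big_ord0//; lia.
rewrite (@lmulE f g N M k N L) ?(@lmulE g f M N k M L) // /L; try lia.
rewrite (reindex_inj rev_ord_inj) /=; apply: eq_bigr => i _.
rewrite mulrC; congr (g _ * f _); have := ltn_ord i; lia.
Qed.

Lemma lmulA : associative lmul.
Proof.
move=> f g h; apply: laurentP => k.
have [N fN] := lcoef_bounded f; have [M gM] := lcoef_bounded g.
have [P hP] := lcoef_bounded h.
pose L := `|(k - N - M - P)%R|%N.+1.
have fgB i : i < N + M -> lmul f g i = 0.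
  by move=> iNM; rewrite (@lmulE f g N M i N 0)// ?big_ord0//; lia.
have ghB i : i < M + P -> lmul g h i = 0.
  by move=> iNM; rewrite (@lmulE g h M P i M 0)// ?big_ord0//; lia.
rewrite (@lmulE f (lmul g h) N (M + P) k N L) //; last by rewrite /L; lia.
rewrite (@lmulE (lmul f g) h (N + M) P k (N + M) L) //; last by rewrite /L; lia.
under eq_bigr => i _.
  rewrite (@lmulE g h M P _ (M - i%:Z) L) //; [|lia|rewrite /L; lia].
  rewrite big_distrr; over.
rewrite exchange_big; apply: eq_bigr => j _.
rewrite (@lmulE f g N M _ N L) //; last by have := ltn_ord j; lia.
rewrite big_distrl /=; apply: eq_bigr => i _.
by rewrite mulrA; congr (_ * g _ * h _); lia.
Qed.

Lemma lmul1 : left_id (lmonom 0) lmul.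
Proof.
move=> f; apply: laurentP => k; have [N fN] := lcoef_bounded f.
rewrite (@lmulE _ f 0 N k 0 (`|(k - N)%R|%N).+1)//; last lia.
  rewrite big_ord_recl /= big1 => [|i _]; first by rewrite mul1r !subr0 addr0.
  by rewrite /= mul0r.
by move=> i i0; rewrite /= lt_eqF.
Qed.

Lemma lmulDl : left_distributive lmul ladd.
Proof.
move=> f g h; apply: laurentP => k.
have [N fN] := lcoef_bounded f; have [M gM] := lcoef_bounded g.
have [P hP] := lcoef_bounded h.
pose a := Order.min N M; pose L := (`|(k - P - a)%R|%N).+1.
have aN : a <= N by rewrite ge_min lexx.
have aM : a <= M by rewrite ge_min lexx orbT.
have fa i : i < a -> f i = 0 by move=> ia; apply: fN; lia.
have ga i : i < a -> g i = 0 by move=> ia; apply: gM; lia.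
have fga i : i < a -> ladd f g i = 0 by move=> ia /=; rewrite fa ?ga ?addr0.
rewrite [RHS](_ : _ = lmul f h k + lmul g h k)//.
rewrite !(@lmulE _ h a P k a L)//; try by rewrite /L; lia.
by rewrite -big_split /=; apply: eq_bigr => i _; rewrite mulrDl.
Qed.

Lemma lone_neq0 : lmonom 0 != 0.
Proof.
apply/eqP => /(congr1 (fun f : laurent => f 0)) /=.
by move/eqP; rewrite oner_eq0.
Qed.

HB.instance Definition _ := GRing.Zmodule_isComNzRing.Build laurent
  lmulA lmulC lmul1 lmulDl lone_neq0.

Section Inverse.
Variable u : nat -> F.

Fixpoint inv_coefs (n : nat) : seq F :=
  if n is m.+1 then
    let w := inv_coefs m in
    rcons w (((m == 0)%:R - \sum_(j < m) w`_j * u (m - j)) / u 0)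
  else [::].

Definition inv_coef n := (inv_coefs n.+1)`_n.

Lemma size_inv_coefs n : size (inv_coefs n) = n.
Proof. by elim: n => //= n IH; rewrite size_rcons IH. Qed.

Lemma nth_inv_coefs n j : (j < n)%N -> (inv_coefs n)`_j = inv_coef j.
Proof.
elim: n => // n IH; rewrite ltnS leq_eqVlt => /predU1P[->//|jn] /=.
by rewrite nth_rcons size_inv_coefs jn IH.
Qed.

Lemma inv_coefP n : u 0 != 0 ->
  \sum_(j < n.+1) inv_coef j * u (n - j) = (n == 0)%:R.
Proof.
move=> u0; rewrite big_ord_recr /= subnn [inv_coef n]/inv_coef /=.
rewrite nth_rcons size_inv_coefs ltnn eqxx divfK//.
under eq_bigr => i _ do rewrite -(nth_inv_coefs (ltn_ord i)).
by rewrite addrC subrK.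
Qed.
End Inverse.

Lemma linv_exists f : f != 0 -> exists g, g * f = 1.
Proof.
move=> f0; have [N fN] := lcoef_bounded f.
have exn : exists n : nat, f (N + n%:Z) != 0.
  apply: contra_notP (elimN eqP f0) => fn; apply: laurentP => j /=.
  have [/fN //|Nj] := ltP j N.
  apply/eqP; apply: contra_notT fn => fj; exists `|(j - N)%R|%N.
  by rewrite (_ : N + _ = j) //; lia.
have [v0 fv0 minv] := ex_minnP exn.
pose v := N + v0%:Z; pose u n := f (v + n%:Z).
have fv j : j < v -> f j = 0.
  have [/fN //|Nj] := ltP j N; move=> jv; apply/eqP; apply: contraTT jv => fj.
  have := minv `|(j - N)%R|%N; rewrite (_ : N + `|(j - N)%R|%N%:Z = j); last lia.
  by move=> /(_ fj); rewrite /v; lia.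
have u0 : u 0 != 0 by rewrite /u addr0.
have gB : exists M : int, forall j, j < M ->
    (if j < - v then 0 else inv_coef u `|(j + v)%R|%N) = 0.
  by exists (- v) => j ->.
exists (MkLaurent gB); apply: laurentP => k.
rewrite [LHS](_ : _ = lmul (MkLaurent gB) f k)// [RHS]/=.
have gv i : i < - v -> MkLaurent gB i = 0 by move=> /= ->.
have [k0|k0] := ltP k 0.
  by rewrite (@lmulE _ _ (- v) v k (- v) 0) ?big_ord0 ?lt_eqF//; lia.
rewrite (@lmulE _ _ (- v) v k (- v) (`|k|%N).+1)//; last lia.
have -> : (k == 0) = (`|k|%N == 0)%N by lia.
rewrite -(inv_coefP _ u0); apply: eq_bigr => i _ /=.
rewrite (_ : (_ < _) = false); last lia.
congr (inv_coef u _ * f _); [lia|have := ltn_ord i; lia].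
Qed.

Definition linv f : laurent := xget 0 [set g | g * f = 1].

Lemma lmulV f : f != 0 -> linv f * f = 1.
Proof.
by move=> /linv_exists[g gf]; rewrite /linv; case: xgetP => [h _ //|/(_ g)].
Qed.

Lemma linv0 : linv 0 = 0.
Proof.
rewrite /linv; case: xgetP => // g _ /= /eqP.
by rewrite mulr0 eq_sym oner_eq0.
Qed.

HB.instance Definition _ := GRing.ComNzRing_isField.Build laurent lmulV linv0.

End Laurent.

(* [inl i] is the [i]-th bottom point, [inr j] the [j]-th top point, both
   counted from the left, starting from 0. *)
Definition bpoint (k l : nat) : finType := ('I_k + 'I_l)%type.

(* The rank of a point when one walks along the boundary of the strip:
   bottom points from left to right, then top points from right to left. *)
Definition bpos k l (x : bpoint k l) : nat :=
  match x with inl i => i | inr j => (k + (l - j.+1))%N end.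

Definition is_tangle k l (f : {ffun bpoint k l -> bpoint k l}) : bool :=
  [forall x, (f x != x) && (f (f x) == x)] &&
  [forall x, forall y,
     ~~ [&& bpos x < bpos y, bpos y < bpos (f x) & bpos (f x) < bpos (f y)]%N].

(* A crossingless matching of the boundary points, as the involution that
   exchanges the two endpoints of every arc. *)
Record tangle k l := MkTangle {
  arc :> {ffun bpoint k l -> bpoint k l};
  _ : is_tangle arc }.

HB.instance Definition _ k l := [isSub for @arc k l].
HB.instance Definition _ k l := [Finite of tangle k l by <:].

Definition swap_pt k l (x : bpoint k l) : bpoint l k :=
  match x with inl i => inr i | inr j => inl j end.

Lemma swap_ptK k l : cancel (@swap_pt k l) (@swap_pt l k).
Proof. by case. Qed.

Lemma bpos_swap k l (x : bpoint k l) :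
  (bpos (swap_pt x) + bpos x).+1 = (k + l)%N.
Proof. by case: x => i /=; have := ltn_ord i; lia. Qed.

Lemma bpos_swap_lt k l (x y : bpoint k l) :
  (bpos (swap_pt y) < bpos (swap_pt x))%N -> (bpos x < bpos y)%N.
Proof.
have := bpos_swap x; have := bpos_swap y.
move: (bpos x) (bpos y) (bpos (swap_pt x)) (bpos (swap_pt y)) => *; lia.
Qed.

Fact mirror_subproof k l (t : tangle k l) :
  is_tangle [ffun x : bpoint l k => swap_pt (t (swap_pt x))].
Proof.
case: t => t /= /andP[/forallP inv_t /forallP nc_t].
apply/andP; split.
  apply/forallP => x; rewrite !ffunE swap_ptK.
  have /andP[ft /eqP ->] := inv_t (swap_pt x); rewrite swap_ptK eqxx andbT.
  by apply: contra ft => /eqP {2}<-; rewrite swap_ptK.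
apply/forallP => x; apply/forallP => y; rewrite !ffunE.
have /andP[_ /eqP ttx] := inv_t (swap_pt x).
have /andP[_ /eqP tty] := inv_t (swap_pt y).
have := forallP (nc_t (t (swap_pt y))) (t (swap_pt x)); rewrite ttx tty.
apply: contra => /and3P[xy yfx fxfy].
by apply/and3P; split; apply: bpos_swap_lt; rewrite ?swap_ptK.
Qed.

Definition mirror k l (t : tangle k l) : tangle l k :=
  MkTangle (mirror_subproof t).

Section Stacking.
Variables (k l m : nat) (t1 : tangle l m) (t2 : tangle k l).

(* The points of the stack: those of [t2], and the top points of [t1]. *)
Definition spoint : finType := (bpoint k l + 'I_m)%type.

Definition from_lower (x : bpoint k l) : spoint := inl x.
Definition from_upper (x : bpoint l m) : spoint :=
  match x with inl j => inl (inr j) | inr j => inr j end.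
Definition from_outer (x : bpoint k m) : spoint :=
  match x with inl i => inl (inl i) | inr j => inr j end.

Definition stack_edge : rel spoint := fun v w =>
  [exists x, (v == from_lower x) && (w == from_lower (t2 x))] ||
  [exists y, (v == from_upper y) && (w == from_upper (t1 y))].

(* [t] is the tangle obtained from [t1] on top of [t2] after removal of the
   closed circles. *)
Definition is_stack (t : tangle k m) : bool :=
  [forall x, connect stack_edge (from_outer x) (from_outer (t x))].

Definition closed_circles : nat :=
  n_comp stack_edge
    [pred v | ~~ [exists x, connect stack_edge v (from_outer x)]].

End Stacking.

Definition TL (R : fieldType) (k l : nat) := {ffun tangle k l -> R^o}.

HB.instance Definition _ R k l := GRing.Lmodule.on (TL R k l).

Section TemperleyLieb.
Variables (R : fieldType) (q : R).

(* [x] is on top of [y]. *)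
Definition tl_comp k l m (x : TL R l m) (y : TL R k l) : TL R k m :=
  [ffun t => \sum_(t1 : tangle l m) \sum_(t2 : tangle k l | is_stack t1 t2 t)
               x t1 * y t2 * (- (q + q^-1)) ^+ closed_circles t1 t2].

Definition tl_id n : TL R n n :=
  [ffun t : tangle n n => [forall i : 'I_n, t (inl i) == inr i]%:R].

(* Bottom points are numbered from 0: the arc joins the bottom points [i] and
   [i.+1], and [cap_i] makes sense for [i.+1 < n]. *)
Definition is_cap n (i : nat) (t : tangle n (n - 2)) : bool :=
  [forall x : 'I_n, forall y : 'I_n,
     ((x == i :> nat) && (y == i.+1 :> nat)) ==> (t (inl x) == inl y)] &&
  [forall j : 'I_(n - 2), forall x : 'I_n,
     (x == (if j < i then j : nat else j.+2)%N :> nat) ==>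
       (t (inl x) == inr j)].

Definition tl_cap n i : TL R n (n - 2) := [ffun t => (is_cap i t)%:R].
Definition tl_cup n i : TL R (n - 2) n := [ffun t => (is_cap i (mirror t))%:R].
Definition tl_U n i : TL R n n := tl_comp (tl_cup n i) (tl_cap n i).

Definition is_jones_wenzl n (P : TL R n n) : Prop :=
  [/\ P != 0, tl_comp P P = P &
      forall i, (i.+1 < n)%N -> tl_comp (tl_cap n i) P = 0].

End TemperleyLieb.

Definition ratfun : fieldType := {fraction {poly rat}}.
Definition ratfun_q : ratfun := tofrac ('X : {poly rat}).

(* The unique solution of [is_jones_wenzl] (and 0 if there were none, or more
   than one). *)
Definition jones_wenzl n : TL ratfun n n :=
  xget 0 [set P : TL ratfun n n | unique (is_jones_wenzl ratfun_q (n := n)) P].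

(* A word [:: i1; i2; ...] stands for sigma_(i1) sigma_(i2) ...; generators are
   numbered from 0, like [tl_cap].  The parameter q is [s ^+ 2]. *)
Definition bracket_gen (R : fieldType) (s : R) n i : TL R n n :=
  s *: tl_U (s ^+ 2) n i + s^-1 *: tl_id R n.

Definition bracket (R : fieldType) (s : R) n (w : seq nat) : TL R n n :=
  foldr (fun i x => tl_comp (s ^+ 2) (bracket_gen s n i) x) (tl_id R n) w.

Definition torus_braid (m n : nat) : seq nat :=
  flatten (nseq (m * n) (iota 0 (n - 1))).

(* Laurent series in q^(1/2): the coefficient of index j is that of q^(j/2). *)
Definition lseries : fieldType := laurent rat.
Definition qhalf : lseries := lmonom rat 1.

(* The quotient of the numerator by the denominator, both evaluated at
   q = (q^(1/2))^2, in the field of Laurent series. *)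
Definition lexpand (x : ratfun) : lseries :=
  (map_poly (ratr : rat -> lseries) (frac (repr x)).1).[qhalf ^+ 2] /
  (map_poly (ratr : rat -> lseries) (frac (repr x)).2).[qhalf ^+ 2].

Definition tl_expand k l (x : TL ratfun k l) : TL lseries k l :=
  [ffun t => lexpand (x t)].

(* Twice m, since indices count powers of q^(1/2). *)
Definition O_plus k l (m : int) (x : TL lseries k l) : Prop :=
  forall (t : tangle k l) (j : int), j < m * 2 -> lcoef (x t) j = 0.

Definition q_order k l (x : TL lseries k l) : \bar int :=
  supremum -oo%E [set (m%:E)%E | m in [set m : int | O_plus m x]].

Definition tl_converges k l (a : nat -> TL lseries k l) (b : TL lseries k l) :=
  forall M : int, \forall i \near \oo%classic, (M%:E <= q_order (b - a i)%R)%E.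

(* Main.v *)
(* Write A_i = q^(1/2) sigma_i = 1 + q U_i and C = A_1 ... A_(n-1), so that the
   normalized braid is C^(mn).  In the basis of tangles A_i has coefficients in
   Z[q], and modulo q it is the projection that kills the tangles with a cup at
   the i-th place.  Every non-identity tangle has such a cup for some i, so C
   maps the lattice they span into q times itself.  Since C P = P and the
   identity has coefficient 1 in P, C^k - P = C^k (1 - P) = O(q^k).

   Existence of P.  As C - 1 is injective on the span I of the non-identity
   tangles, there is x in 1 + I with C x = x.  Put y_i = U_i x, an element of I.
   From C U_i = U_(i+1) C we get y_(i+1) = C^i y_1, and expanding C x = x gives
   sum_i A_1 ... A_(i-1) y_i = 0.  The terms i > 1 are divisible by q relative
   to y_1, which forces y_1 = 0, so that x is annihilated by all the U_i. *)

From HB Require Import structures.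
Require Import Defs.
From mathcomp Require Import all_boot all_order all_algebra.
From mathcomp Require Import boolp classical_sets filter constructive_ereal
  zify ring.

Set Implicit Arguments.
Unset Strict Implicit.
Unset Printing Implicit Defensive.

Import Order.TTheory GRing.Theory Num.Theory.
Local Open Scope ring_scope.

(** Stacking is defined through connectivity in a graph, so associativity of composition would be
    costly, and it is never proved. A bracket multiplies generators from the left one at a time,
    hence the left action of the generators on tangles suffices. Each generator sends a tangle to a
    power of -(q + q^-1) times a single tangle, and [tl_action] records the combinatorial facts
    about this action on which the algebra rests. Associativity seems unavoidable at one place only:
    that an idempotent killed by all caps has identity coefficient 1. There it is enough that a
    tangle with a bottom cap at i, stacked on U_i x, gives -(q + q^-1) times what it gives on x,
    which is a count of circles.

    P lives over Q(q), where the order argument is not directly at hand. The linear system for P is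
    solved over Q(q) by dimension, and its injectivity is tested after embedding Q(q) into Laurent
    series. So [lexpand], computed from a chosen numerator and denominator, has to be shown to be a
    morphism of fields. *)

(* Innermost conditions first, so that no hypothesis contains an [if]. *)
Ltac decide_eqs :=
  repeat (match goal with
  | |- context [?u == ?v] =>
    lazymatch constr:((u, v)) with
    | context [if _ then _ else _] => fail
    | _ => case: (@eqP _ u v) => /= ?
    end
  end; try congruence); try congruence.

(** * The action of a generator on arcs *)

Section Surgery.
Variable T : eqType.
Implicit Types (f : T -> T) (a b c d x : T).

(* The effect of stacking u_i on a matching f, for a and b the i-th and (i+1)-st
   top points: a is joined to b, and their former partners are joined. *)
Definition surgery a b f x :=
  if x == a then b else if x == b then a else
  if x == f a then f b else if x == f b then f a else f x.

Lemma surgery_id a b f : involutive f -> f a = b -> surgery a b f =1 f.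
Proof.
move=> fK fab x; rewrite /surgery; have fba : f b = a by rewrite -fab fK.
by do ![case: eqP => [->|?]//]; congruence.
Qed.

Lemma surgeryK a b f : involutive f -> (forall y, f y != y) ->
  involutive (surgery a b f).
Proof.
move=> fK f0 x; have /eqP := f0 a; have /eqP := f0 b; have := fK x;
  have := fK a; have := fK b; rewrite /surgery => *.
by decide_eqs.
Qed.

Lemma surgery_neq a b f x : involutive f -> (forall y, f y != y) ->
  a != b -> surgery a b f x != x.
Proof.
move=> fK f0 /eqP ab; apply/eqP; rewrite /surgery.
have := fK x; have := fK a; have := fK b.
have /eqP := f0 x; have /eqP := f0 a; have /eqP := f0 b => *.
by decide_eqs.
Qed.

Lemma surgery_l a b f : surgery a b f a = b.
Proof. by rewrite /surgery eqxx. Qed.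

Lemma surgery_r a b f : surgery a b f b = a.
Proof. by rewrite /surgery eqxx; case: eqP. Qed.

Lemma surgery_fl a b f : f a != a -> f a != b -> surgery a b f (f a) = f b.
Proof. by rewrite /surgery eqxx => /negPf-> /negPf->. Qed.

Lemma surgery_other a b f x : involutive f -> x != a -> x != b ->
  f x != a -> f x != b -> surgery a b f x = f x.
Proof.
move=> fK; rewrite /surgery => /negPf-> /negPf-> fxa fxb.
by rewrite -!(can2_eq fK fK) (negPf fxa) (negPf fxb).
Qed.

Lemma surgeryC a b f : surgery a b f =1 surgery b a f.
Proof. by move=> x; rewrite /surgery; decide_eqs. Qed.

Lemma eq_surgery a b f g : f =1 g -> surgery a b f =1 surgery a b g.
Proof. by move=> fg x; rewrite /surgery !fg. Qed.

Lemma surgery_braid a b c f : involutive f ->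
  uniq [:: a; b; c] ->
  surgery a b (surgery b c (surgery a b f)) =1 surgery a b f.
Proof.
rewrite /= !inE negb_or !andbT => fK /andP[/andP[/eqP ab /eqP ac] /eqP bc] x.
have := fK x; have := fK a; have := fK b; have := fK c; rewrite /surgery => *.
by decide_eqs.
Qed.

Lemma surgery_comm a b c d f : involutive f -> (forall y, f y != y) ->
  uniq [:: a; b; c; d] ->
  surgery a b (surgery c d f) =1 surgery c d (surgery a b f).
Proof.
rewrite /= !inE !negb_or !andbT => fK f0.
move=> /and3P[/and3P[/eqP ab /eqP ac /eqP ad] /andP[/eqP bc /eqP bd] /eqP cd] x.
have := fK x; have := fK a; have := fK b; have := fK c; have := fK d.
have /eqP := f0 a; have /eqP := f0 b; have /eqP := f0 c; have /eqP := f0 d.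
rewrite /surgery => *.
by decide_eqs.
Qed.

(** This is the equality of circle counts for two distant generators. Only the totals agree: if f
    joins a to c and b to d, neither cup is there at first, but either surgery creates the other
    one, so each order closes one circle, in its second step. *)
Lemma surgery_comm_cups a b c d f : involutive f -> (forall y, f y != y) ->
  uniq [:: a; b; c; d] ->
  ((f c == d) + (surgery c d f a == b) = (f a == b) + (surgery a b f c == d))%N.
Proof.
rewrite /= !inE !negb_or !andbT => fK f0.
move=> /and3P[/and3P[/eqP ab /eqP ac /eqP ad] /andP[/eqP bc /eqP bd] /eqP cd].
have := fK a; have := fK b; have := fK c; have := fK d.
have /eqP := f0 a; have /eqP := f0 b; have /eqP := f0 c; have /eqP := f0 d.
rewrite /surgery => *.
by decide_eqs.
Qed.
End Surgery.

(** * Planarity: its preservation under surgery, and innermost arcs *)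

Section TangleTheory.
Variables k l : nat.
Implicit Types (t : tangle k l) (x y a b : bpoint k l).

Lemma arcK t : involutive t.
Proof. by case: t => f /= /andP[/forallP H _] x; have /andP[_ /eqP] := H x. Qed.

Lemma arc_neq t x : t x != x.
Proof. by case: t => f /= /andP[/forallP H _]; have /andP[] := H x. Qed.

Lemma arc_nc t x y :
  ~~ [&& bpos x < bpos y, bpos y < bpos (t x) & bpos (t x) < bpos (t y)]%N.
Proof. by case: t => f /= /andP[_ /forallP/(_ x)/forallP]; apply. Qed.

Lemma tangle_ext t t' : t =1 t' -> t = t'.
Proof. by move=> E; apply/val_inj/ffunP. Qed.

Lemma bpos_inj : injective (@bpos k l).
Proof.
move=> [i|i] [j|j] /= E; have := ltn_ord i; have := ltn_ord j => *;
  try (by exfalso; lia); congr (_ _); apply: val_inj => /=; lia.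
Qed.

Definition noncrossing (f : bpoint k l -> bpoint k l) := forall x y,
  ~~ [&& bpos x < bpos y, bpos y < bpos (f x) & bpos (f x) < bpos (f y)]%N.

Lemma is_tangle_finfun (f : bpoint k l -> bpoint k l) : involutive f ->
  (forall x, f x != x) -> noncrossing f -> is_tangle (finfun f).
Proof.
move=> fK f0 nc; apply/andP; split.
  by apply/forallP => x; rewrite !ffunE f0 fK eqxx.
by apply/forallP => x; apply/forallP => y; rewrite !ffunE.
Qed.

Definition between (p q r : nat) := ((p < r < q) || (q < r < p))%N.

(** The definition excludes one pattern of inequalities; applied to both ends of both arcs, it
    yields this order-free form: no arc separates the ends of another. *)
Lemma noncrossing_between (f : bpoint k l -> bpoint k l) x y :
  involutive f -> noncrossing f -> y != x -> y != f x ->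
  between (bpos x) (bpos (f x)) (bpos (f y)) =
  between (bpos x) (bpos (f x)) (bpos y).
Proof.
move=> fK nc yx yfx.
have ncl u v : (bpos u < bpos v -> bpos v < bpos (f u) ->
  bpos (f u) < bpos (f v) -> False)%N.
  by move=> *; have /negP := nc u v; apply; apply/and3P.
have p_neq (u v : bpoint k l) : u != v ->
  bpos u != bpos v by rewrite (inj_eq bpos_inj).
have fyx : f y != x by apply: contra yfx => /eqP <-; rewrite fK.
have fyfx : f y != f x by rewrite (inj_eq (inv_inj fK)).
move: (ncl x y) (ncl y x) (ncl x (f y)) (ncl (f y) x).
move: (ncl (f x) y) (ncl y (f x)) (ncl (f x) (f y)) (ncl (f y) (f x)).
move: (p_neq _ _ yx) (p_neq _ _ yfx) (p_neq _ _ fyx) (p_neq _ _ fyfx).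
rewrite !fK /between; lia.
Qed.

Lemma surgery_noncrossing a b (f : bpoint k l -> bpoint k l) :
  involutive f -> (forall x, f x != x) -> noncrossing f ->
  bpos b = (bpos a).+1 -> noncrossing (surgery a b f).
Proof.
move=> fK f0 nc ab.
have p_neq (u v : bpoint k l) : u != v ->
  bpos u != bpos v by rewrite (inj_eq bpos_inj).
(* An arc does not separate a from b,
  hence it does not separate f a from f b. *)
have sep z : z != a -> z != b -> z != f a -> z != f b ->
    between (bpos z) (bpos (f z)) (bpos (f a)) =
    between (bpos z) (bpos (f z)) (bpos (f b)).
  move=> za zb zfa zfb.
  have fza : f z != a by apply: contra zfa => /eqP <-; rewrite fK.
  have fzb : f z != b by apply: contra zfb => /eqP <-; rewrite fK.
  rewrite !noncrossing_between // 1?eq_sym //.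
  move: (p_neq _ _ za) (p_neq _ _ zb) (p_neq _ _ fza) (p_neq _ _ fzb).
  rewrite /between; lia.
move=> x y; apply/negP => /and3P[]; rewrite /surgery.
have := sep x; have := sep y; rewrite /between.
case: (eqVneq x a) => [->|xa]; first lia.
case: (eqVneq x b) => [->|xb]; first lia.
case: (eqVneq y a) => [->|ya]; first lia.
case: (eqVneq y b) => [->|yb]; first lia.
case: (eqVneq x (f a)) => [->|xfa].
  case: (eqVneq y (f a)) => [->|yfa]; first lia.
  case: (eqVneq y (f b)) => [->|yfb]; first lia.
  by move=> /(_ isT isT isT isT); lia.
case: (eqVneq x (f b)) => [->|xfb].
  case: (eqVneq y (f a)) => [->|yfa]; first lia.
  case: (eqVneq y (f b)) => [->|yfb]; first lia.
  by move=> /(_ isT isT isT isT); lia.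
case: (eqVneq y (f a)) => [->|yfa].
  by move=> _ /(_ isT isT isT isT); lia.
case: (eqVneq y (f b)) => [->|yfb].
  by move=> _ /(_ isT isT isT isT); lia.
by move=> _ _ xy yfx fxfy; have /negP := nc x y; apply; apply/and3P.
Qed.

(** [insubd] makes the operation total, with [t] as default when the surgery is not planar. No
    adjacency proof is carried along, so generators can be indexed by natural numbers. *)
Definition reconnect a b t : tangle k l :=
  insubd t (finfun (surgery a b t)).

Lemma reconnectE a b t : bpos b = (bpos a).+1 ->
  reconnect a b t =1 surgery a b t.
Proof.
move=> ab x; have nab : a != b by apply/eqP => E; move: ab; rewrite E; lia.
rewrite /reconnect val_insubd is_tangle_finfun ?ffunE //.
- exact: surgeryK (@arcK t) (@arc_neq t).
- by move=> y; exact: surgery_neq (@arcK t) (@arc_neq t) nab.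
- exact: surgery_noncrossing (@arcK t) (@arc_neq t) (@arc_nc t) ab.
Qed.
End TangleTheory.

(** The partner of the point i + 1 is trapped under the arc from i to j, hence is a top point, and
    the arc from i + 1 is shorter. *)
Lemma top_arc_innermost k l (t : tangle k l) (i j : 'I_l) :
  (i < j)%N -> t (inr i) = inr j ->
  exists a b : 'I_l, b = a.+1 :> nat /\ t (inr a) = inr b.
Proof.
have [m] := ubnP (j - i); elim: m i j => // m IH i j jim ij tij.
have [ji|ji] := eqVneq (j : nat) i.+1; first by exists i, j.
have ail : (i.+1 < l)%N by have := ltn_ord j; lia.
pose a := Ordinal ail; have := ltn_ord j => jl.
have ai : inr a != inr i :> bpoint k l by apply/eqP => -[/(congr1 val)/=]; lia.
have aj : inr a != inr j :> bpoint k l by apply/eqP => -[/(congr1 val)/=]; lia.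
have aa := arc_neq t (inr a).
have /= := noncrossing_between (@arcK _ _ t) (@arc_nc _ _ t) ai.
rewrite tij => /(_ aj); case ta: (t (inr a)) aa => [c|b] aa /=.
  by have := ltn_ord c; rewrite /between; lia.
have {aa}ab : (b : nat) != i.+1 by apply: contra aa => /eqP E; apply/eqP;
  congr inr; apply: val_inj.
have := ltn_ord b => bl; rewrite /between => bb.
by apply: (IH a b) => //=; lia.
Qed.

(** Without top arcs, [g] maps top points to bottom points and increases strictly by planarity.
    Counting from the left ([ge]) and from the right ([le]) forces it to be the identity. *)
Lemma through_strands k l n (t : tangle k l) : k = n -> l = n ->
  (forall i j, t (inr i) != inr j) ->
  forall (i : 'I_l) (j : 'I_k), i = j :> nat -> t (inr i) = inl j.
Proof.
move=> kn ln tt; pose g (i : 'I_l) : nat := bpos (t (inr i)).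
have tg (i : 'I_l) : (g i < k)%N /\ forall j : 'I_k, g i = j ->
  t (inr i) = inl j.
  rewrite /g; case ti: (t (inr i)) => [c|c]; last by have := tt i c;
    rewrite ti eqxx.
  by split=> [|j /= /val_inj ->]; first exact: ltn_ord.
have g_mono (i j : 'I_l) : (i < j)%N -> (g i < g j)%N.
  move=> ij; have := arc_nc t (t (inr j)) (t (inr i)); rewrite !arcK /=.
  have [gi _] := tg i; have := ltn_ord j; have := ltn_ord i.
  have : g i != g j.
    rewrite /g (inj_eq (@bpos_inj k l)) (inj_eq (inv_inj (@arcK _ _ t))).
    by apply/eqP => -[/(congr1 val)/=]; lia.
  move: gi; rewrite /g; move: (bpos (t (inr i))) (bpos (t (inr j))) => p r. lia.
have ge m (i : 'I_l) : (m <= i -> m <= g i)%N.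
  elim: m i => // m IH i mi; have ml : (m < l)%N by have := ltn_ord i; lia.
  by have := g_mono (Ordinal ml) i mi; have := IH (Ordinal ml) (leqnn m); lia.
have le m (i : 'I_l) : (i + m < l -> g i + m < k)%N.
  elim: m i => [|m IH] i im; first by rewrite addn0; case: (tg i).
  have il : (i.+1 < l)%N by lia.
  have := g_mono i (Ordinal il) (leqnn _).
  by have /= := IH (Ordinal il); rewrite addSnnS => /(_ im); lia.
move=> i j ij; apply: (tg i).2; have := ge _ i (leqnn _); have := ltn_ord i.
by have := le (l - i.+1)%N i; lia.
Qed.

Definition is_id n (t : tangle n n) : bool := [forall i, t (inl i) == inr i].

Lemma not_id_top_arc n (t : tangle n n) : ~~ is_id t ->
  exists a b : 'I_n, b = a.+1 :> nat /\ t (inr a) = inr b.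
Proof.
move=> tid; apply: contrapT => no_arc; case/negP: tid; apply/forallP => i.
suff tt a b : t (inr a) != inr b.
  by rewrite -(through_strands (erefl n) (erefl n) tt (erefl (i : nat))) arcK.
apply/eqP => tab; apply: no_arc.
have : a != b by apply: contra_eq_neq tab => ->; exact: arc_neq.
rewrite -(inj_eq val_inj) neq_ltn => /orP[ab|ba].
  exact: top_arc_innermost ab tab.
by apply: top_arc_innermost ba _; rewrite -tab arcK.
Qed.

Lemma not_id_bottom_arc n (t : tangle n n) : ~~ is_id t ->
  exists a b : 'I_n, b = a.+1 :> nat /\ t (inl a) = inl b.
Proof.
move=> tid; have /not_id_top_arc[a [b [ab tab]]] : ~~ is_id (mirror t).
  apply: contra tid => /forallP mt; apply/forallP => i.
  have := mt i; rewrite ffunE /= => /eqP/(congr1 (@swap_pt _ _)).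
  by rewrite swap_ptK /= => <-; rewrite arcK.
exists a, b; split=> //; move: tab; rewrite ffunE /=.
by move/(congr1 (@swap_pt _ _)); rewrite swap_ptK.
Qed.

(** * Components of stacked tangles *)

Lemma connect_ind (T : finType) (e : rel T) (P : T -> Prop) v w :
  P v -> (forall x y, P x -> e x y -> P y) -> connect e v w -> P w.
Proof.
move=> Pv Pe /connectP[p]; elim: p v Pv => [|u p IH] v Pv /=;
  first by move=> _ ->.
by move=> /andP[vu pu] wE; apply: IH pu wE; apply: Pe vu.
Qed.

Section Stacks.
Variables (k l m : nat) (t1 : tangle l m) (t2 : tangle k l).
Let edge := stack_edge t1 t2.

Lemma stack_edgeP v w : reflect
  ((exists x, v = from_lower m x /\ w = from_lower m (t2 x)) \/
   (exists y, v = from_upper k y /\ w = from_upper k (t1 y)))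
  (edge v w).
Proof.
apply: (iffP orP) => -[].
- by move=> /existsP[x /andP[/eqP-> /eqP->]]; left; exists x.
- by move=> /existsP[x /andP[/eqP-> /eqP->]]; right; exists x.
- by move=> [x [-> ->]]; left; apply/existsP; exists x; rewrite !eqxx.
- by move=> [x [-> ->]]; right; apply/existsP; exists x; rewrite !eqxx.
Qed.

Lemma stack_edge_lower x : edge (from_lower m x) (from_lower m (t2 x)).
Proof. by apply/stack_edgeP; left; exists x. Qed.

Lemma stack_edge_upper y : edge (from_upper k y) (from_upper k (t1 y)).
Proof. by apply/stack_edgeP; right; exists y. Qed.

Lemma stack_edge_sym : symmetric edge.
Proof.
suff H v w : edge v w -> edge w v by move=> v w; apply/idP/idP; apply: H.
move=> /stack_edgeP[[x [-> ->]]|[x [-> ->]]].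
  by have := stack_edge_lower (t2 x); rewrite arcK.
by have := stack_edge_upper (t1 x); rewrite arcK.
Qed.

Lemma stack_connect_sym : connect_sym edge.
Proof. exact: sym_connect_sym stack_edge_sym. Qed.

(* To identify the result t of a stacking it suffices to give a map r sending
   each point to an outer point of its component, and closed circles to None. *)
Section Retraction.
Variables (t : tangle k m) (r : spoint k l m -> option (bpoint k m)).

Definition same_arc (o o' : option (bpoint k m)) : bool :=
  match o, o' with
  | Some x, Some y => (y == x) || (y == t x)
  | None, None => true
  | _, _ => false
  end.

Lemma same_arc_trans o1 o2 o3 :
  same_arc o1 o2 -> same_arc o2 o3 -> same_arc o1 o3.
Proof.
case: o1 o2 o3 => [x|] [y|] [z|] //= /orP[]/eqP-> /orP[]/eqP->;
  by rewrite ?arcK eqxx ?orbT.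
Qed.

Hypothesis r_outer : forall x, r (from_outer l x) = Some x.
Hypothesis r_connect : forall v x, r v = Some x ->
  connect edge v (from_outer l x).
Hypothesis r_lower : forall x,
  same_arc (r (from_lower m x)) (r (from_lower m (t2 x))).
Hypothesis r_upper : forall y,
  same_arc (r (from_upper k y)) (r (from_upper k (t1 y))).
Hypothesis r_arc : forall x, connect edge (from_outer l x) (from_outer l (t x)).

Lemma retract_connect v w : connect edge v w -> same_arc (r v) (r w).
Proof.
apply: (@connect_ind _ edge (fun w => same_arc (r v) (r w))).
  by case: (r v) => //= x; rewrite eqxx.
move=> x y vx xy; apply: same_arc_trans vx _.
by case/stack_edgeP: xy => -[z [-> ->]].
Qed.

Lemma retract_is_stack t' : is_stack t1 t2 t' = (t' == t).
Proof.
apply/forallP/eqP => [st|-> //].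
apply: tangle_ext => x; have := retract_connect (st x); rewrite !r_outer /=.
by rewrite (negPf (arc_neq t' x)) => /eqP.
Qed.

Lemma retract_closed_circles :
  closed_circles t1 t2 = n_comp edge [pred v | r v == None].
Proof.
apply: eq_n_comp_r => v; rewrite !inE -[RHS]negbK; congr (~~ _).
apply/existsP/idP => [[x /retract_connect]|]; first by rewrite r_outer;
  case: (r v).
by case rv: (r v) => [x|//] _; exists x; apply: r_connect.
Qed.

Lemma retract_no_circle : (forall v, r v) -> closed_circles t1 t2 = 0%N.
Proof.
move=> rN; rewrite retract_closed_circles; apply: eq_card0 => v; rewrite !inE.
by apply/negP => /andP[_ /eqP rv]; have := rN v; rewrite rv.
Qed.
End Retraction.
End Stacks.

(* If lam joins the bottom points a and b, then stacking lam on u_i mu gives the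
   same connections as stacking it on mu, with one more circle when mu does not
   join the top points a and b: contract the arc a-b onto the partners under
     mu. *)
Section BottomCap.
Variables (k n m : nat) (lam : tangle n m) (mu : tangle k n) (a b : 'I_n).
Hypotheses (ab : b = a.+1 :> nat) (lam_ab : lam (inl a) = inl b).

Lemma bpos_top : bpos (inr a : bpoint k n) = (bpos (inr b : bpoint k n)).+1.
Proof. by rewrite /=; have := ltn_ord b; lia. Qed.

Let mu' := reconnect (inr b) (inr a) mu.
Let mu'E : mu' =1 surgery (inr b) (inr a) mu := reconnectE mu bpos_top.

Let A : spoint k n m := inl (inr a).
Let B : spoint k n m := inl (inr b).
Let e := stack_edge lam mu.
Let e' := stack_edge lam mu'.

Hypothesis mu_ab : mu (inr a) != inr b.

Let mu_ba : mu (inr b) != inr a.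
Proof. by apply: contra mu_ab => /eqP <-; rewrite arcK. Qed.

Let cut (x : bpoint k n) := (x == inr a) || (x == inr b).
Let hp (x : bpoint k n) := if cut x then mu x else x.
Let h (v : spoint k n m) : spoint k n m :=
  match v with inl x => inl (hp x) | inr j => inr j end.

Let cut_mu x : cut x -> ~~ cut (mu x).
Proof.
by rewrite /cut => /orP[]/eqP->; rewrite negb_or arc_neq ?mu_ab ?mu_ba.
Qed.

Let cut_hp x : ~~ cut (hp x).
Proof. by rewrite /hp; case: ifPn => // /cut_mu. Qed.

Let connect_h v : connect e v (h v).
Proof.
case: v => [x|j] //=; rewrite /hp; case: ifP => // _.
exact/connect1/(stack_edge_lower lam mu).
Qed.

Let connect_AB : connect e A B.
Proof.
by apply/connect1; have := stack_edge_upper lam mu (inl a); rewrite lam_ab.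
Qed.

Let connect_fAB : connect e (inl (mu (inr a))) (inl (mu (inr b))).
Proof.
have := connect_h A; have := connect_h B; rewrite /= /hp /cut !eqxx orbT => cB.
rewrite (stack_connect_sym lam mu) => cA.
exact: connect_trans cA (connect_trans connect_AB cB).
Qed.

Let connect_fAB' : connect e' (inl (mu (inr a))) (inl (mu (inr b))).
Proof.
rewrite (stack_connect_sym lam mu').
have := stack_edge_lower lam mu' (mu (inr b)); rewrite /from_lower mu'E.
by rewrite surgery_fl ?arc_neq //; exact: connect1.
Qed.

Let edge'_connect v w : e' v w -> connect e v w.
Proof.
case/stack_edgeP=> -[x [-> ->]]; last exact/connect1/stack_edge_upper.
have csym := stack_connect_sym lam mu.
rewrite /from_lower mu'E /surgery.
case: eqP => [->|_]; first by rewrite csym.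
case: eqP => [->|_] //.
case: eqP => [->|_]; first by rewrite csym.
case: eqP => [->|_] //.
exact/connect1/(stack_edge_lower lam mu).
Qed.

Let contract_edge v w : e v w -> connect e' (h v) (h w).
Proof.
case/stack_edgeP=> -[x [-> ->]] /=.
  rewrite /hp; case: ifPn => [cx|ncx]; first by rewrite (negPf (cut_mu cx)).
  case: ifPn => [_|ncm]; first by rewrite arcK.
  apply/connect1; have := stack_edge_lower lam mu' x; rewrite /from_lower mu'E.
  by move: ncx ncm; rewrite !negb_or => /andP[? ?] /andP[? ?];
    rewrite surgery_other //; exact: arcK.
have csym := stack_connect_sym lam mu'.
have lam_ba : lam (inl b) = inl a by rewrite -lam_ab arcK.
have hA : h A = inl (mu (inr a)) by rewrite /h ?/A ?/B /hp /cut eqxx.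
have hB : h B = inl (mu (inr b)) by rewrite /h ?/A ?/B /hp /cut eqxx orbT.
case: (eqVneq x (inl a)) => [->|xa]; first by rewrite lam_ab -/A -/B hA hB.
case: (eqVneq x (inl b)) => [->|xb].
  by rewrite lam_ba -/A -/B hA hB csym.
have h_upper y : y != inl a -> y != inl b ->
  h (from_upper k y) = from_upper k y.
  case: y => //= j ja jb; congr inl; rewrite /hp ifN // /cut negb_or.
  by apply/andP; split; [move: ja|move: jb]; apply: contra => /eqP[->].
rewrite !h_upper //; first exact/connect1/stack_edge_upper.
  by apply: contra xb => /eqP E; rewrite -(arcK lam x) E lam_ab.
by apply: contra xa => /eqP E; rewrite -(arcK lam x) E lam_ba.
Qed.

Let connect_contract v w : connect e v w = connect e' (h v) (h w).
Proof.
apply/idP/idP => [|hvw].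
  apply: (@connect_ind _ e (fun w => connect e' (h v) (h w))) => // x y vx xy.
  exact: connect_trans vx (contract_edge xy).
have hvw' : connect e (h v) (h w) by apply: connect_sub hvw => x y;
  exact: edge'_connect.
apply: connect_trans (connect_h v) (connect_trans hvw' _).
by rewrite (stack_connect_sym lam mu).
Qed.

Let h_outer x : h (from_outer n x) = from_outer n x.
Proof. by case: x. Qed.

Let comp_AB w : connect e' A w -> w = A \/ w = B.
Proof.
have lam_ba : lam (inl b) = inl a by rewrite -lam_ab arcK.
apply: (@connect_ind _ e' (fun w => w = A \/ w = B)); first by left.
move=> v u [] -> /stack_edgeP[[x [xE ->]]|[[i|j] [xE ->]]] //.
- by case: xE => <-; right; rewrite mu'E surgery_r.
- by case: xE => <-; right; rewrite lam_ab.
- by case: xE => <-; left; rewrite mu'E surgery_l.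
- by case: xE => <-; left; rewrite lam_ba.
Qed.

Lemma reconnect_is_stack t : is_stack lam mu' t = is_stack lam mu t.
Proof. by apply: eq_forallb => x;
  rewrite -/e -/e' connect_contract !h_outer. Qed.

Lemma reconnect_closed_circles :
  closed_circles lam mu' = (closed_circles lam mu).+1.
Proof.
pose C := [pred v | ~~ [exists x, connect e v (from_outer n x)]].
pose C' := [pred v | ~~ [exists x, connect e' v (from_outer n x)]].
have csym := stack_connect_sym lam mu; have csym' := stack_connect_sym lam mu'.
have C'h v : (h v \in C') = (v \in C).
  rewrite !inE; congr (~~ _); apply: eq_existsb => x.
  by rewrite connect_contract h_outer.
have C'_closed : closed e' C'.
  apply: intro_closed => // v w /connect1 vw; rewrite !inE; apply: contra.
  by move=> /existsP[x wx]; apply/existsP; exists x; exact: connect_trans vw wx.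
have AC' w : connect e' A w -> w \in C'.
  move=> Aw; rewrite inE; apply/existsPn => x; apply/negP => wx.
  by case/comp_AB: (connect_trans Aw wx); case: x {wx}.
have hA v : connect e' A (h v) = false.
  apply/negP => /comp_AB; case: v => [x|j] /= []// [E]; have := cut_hp x;
  by rewrite E /cut eqxx ?orbT.
(* [D] is the set of closed circles without the new circle {A, B}. Contraction never meets that
   circle, so it matches the components in [D] with those in [C]; the new circle accounts for the
   successor. *)
pose D := [predD C' & connect e' A].
have D_closed : closed e' D.
  apply: intro_closed => // v w vw; rewrite !inE. move=> /andP[nv Cv].
  apply/andP; split.
    apply: contra nv => Aw; apply: connect_trans Aw _.
    by rewrite csym' connect1.
  by have := C'_closed _ _ vw; rewrite !inE Cv => <-.
have adj : rel_adjunction h e' e D.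
  split=> [x|x' y' _]; last exact: connect_contract.
  rewrite inE /= => /andP[nAx Cx]; exists x.
  case: x nAx Cx => [x|j] //= nAx Cx.
  rewrite /hp ifN //; apply: contra nAx => /orP[]/eqP->; first exact: connect0.
  by apply: connect1; have := stack_edge_upper lam mu' (inl a); rewrite lam_ab.
have nD : n_comp e' D = n_comp e C.
  rewrite (adjunction_n_comp h csym' csym D_closed adj);
    apply: eq_n_comp_r => v.
  by rewrite !inE /= hA /=; have := C'h v; rewrite !inE.
rewrite /closed_circles -/e -/e' -[in RHS]/C -nD -/C'.
rewrite /n_comp_mem -(cardID (connect e' A)) -addn1 addnC; congr (_ + _)%N.
  by apply: eq_card => v; rewrite !inE /=; rewrite andbCA andbA.
rewrite -(n_comp_connect csym' A) /n_comp_mem; apply: eq_card => v;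
  rewrite !inE.
case Av: (connect e' A v); rewrite ?andbF //.
by have := AC' v Av; rewrite inE => ->; rewrite andbT.
Qed.
End BottomCap.

Fact id_tangle_subproof n : is_tangle (finfun (@swap_pt n n)).
Proof.
apply: is_tangle_finfun; [exact: swap_ptK|by case|move=> [i|i] [j|j] /=].
all: by have := ltn_ord i; have := ltn_ord j; lia.
Qed.
Definition id_tangle n : tangle n n := MkTangle (id_tangle_subproof n).

Lemma id_tangleE n x : id_tangle n x = swap_pt x.
Proof. by rewrite ffunE. Qed.

Lemma is_idE n (t : tangle n n) : is_id t = (t == id_tangle n).
Proof.
apply/forallP/eqP => [tid|-> i]; last by rewrite id_tangleE.
apply: tangle_ext => -[i|i]; rewrite id_tangleE /=; first exact/eqP.
by rewrite -[RHS](arcK t) (eqP (tid i)).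
Qed.

(* th follows the strands of the upper tangle from its bottom to its top; its
   value at the endpoints of a bottom cap is irrelevant. *)
Section ThroughUpper.
Variables (k n m : nat) (t1 : tangle n m) (t2 : tangle k n) (t : tangle k m).
Variable th : bpoint k n -> bpoint k m.
Hypothesis th_inl : forall i, th (inl i) = inl i.
Hypothesis t_top : forall i j, t1 (inr i) = inr j -> t (inr i) = inr j.
Let e := stack_edge t1 t2.

Let csym : connect_sym e := stack_connect_sym t1 t2.

Section NoCap.
Hypothesis th_inr : forall y, exists2 j,
  th (inr y) = inr j & t1 (inl y) = inr j.
Hypothesis t_th : forall x, t (th x) = th (t2 x).

Let r (v : spoint k n m) : option (bpoint k m) :=
  match v with inl x => Some (th x) | inr j => Some (inr j) end.

Let r_outer x : r (from_outer n x) = Some x.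
Proof. by case: x => [i|j] //=; rewrite th_inl. Qed.

Let r_connect v x : r v = Some x -> connect e v (from_outer n x).
Proof.
case: v => [[i|y]|j] /= [<-] //; first by rewrite th_inl.
have [j -> t1y] := th_inr y; apply: connect1.
by have := stack_edge_upper t1 t2 (inl y); rewrite t1y.
Qed.

Let r_lower x : same_arc t (r (inl x)) (r (inl (t2 x))).
Proof. by rewrite /= t_th eqxx orbT. Qed.

Let through j y : t1 (inr j) = inl y -> th (inr y) = inr j.
Proof.
move=> tj; have [j' ->] := th_inr y.
by rewrite -tj arcK => -[->].
Qed.

Let r_upper y : same_arc t (r (from_upper k y)) (r (from_upper k (t1 y))).
Proof.
case: y => [y|j] /=; first by have [j -> ->] := th_inr y; rewrite /= eqxx.
case tj: (t1 (inr j)) => [y|j'] /=; last by rewrite (t_top tj) eqxx orbT.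
by rewrite (through tj) eqxx.
Qed.

Let r_arc x : connect e (from_outer n x) (from_outer n (t x)).
Proof.
have main y : connect e (from_outer n (th y)) (from_outer n (t (th y))).
  have := @r_connect (inl y) _ erefl; rewrite t_th csym => cy.
  apply: connect_trans cy (connect_trans (connect1 (stack_edge_lower t1 t2 y))
    _).
  exact: (@r_connect (inl (t2 y)) _ erefl).
case: x => [i|j]; first by rewrite -th_inl.
case tj: (t1 (inr j)) => [y|j']; first by rewrite -(through tj).
rewrite (t_top tj); apply: connect1.
by have := stack_edge_upper t1 t2 (inr j); rewrite tj.
Qed.

Lemma through_is_stack t' : is_stack t1 t2 t' = (t' == t).
Proof. exact: (retract_is_stack r_outer r_lower r_upper r_arc). Qed.

Lemma through_closed_circles : closed_circles t1 t2 = 0%N.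
Proof.
by apply: (retract_no_circle r_outer r_connect r_lower r_upper) => -[].
Qed.
End NoCap.

Section Cap.
Variables a b : 'I_n.
Hypotheses (ab : b = a.+1 :> nat) (t1_ab : t1 (inl a) = inl b).
Let cut (x : bpoint k n) := (x == inr a) || (x == inr b).
Hypothesis th_inr : forall y, ~~ cut (inr y) ->
  exists2 j, th (inr y) = inr j & t1 (inl y) = inr j.
Hypothesis t_th : forall x, ~~ cut x ->
  t (th x) = th (reconnect (inr b) (inr a) t2 x).

Let cup := t2 (inr a) == inr b.
(** At an end of the cap [th] means nothing, so the strand is followed through [t2] instead. If this
    leads to the other end of the cap, the two arcs form a closed circle, whence [None]. *)
Let r (v : spoint k n m) : option (bpoint k m) :=
  match v with
  | inl x => if cut x then if cup then None else Some (th (t2 x))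
             else Some (th x)
  | inr j => Some (inr j)
  end.

Let eE : reconnect (inr b) (inr a) t2 =1 surgery (inr b) (inr a) t2 :=
  reconnectE t2 (bpos_top k ab).

Let cup_ba : cup = (t2 (inr b) == inr a).
Proof. by rewrite /cup (can2_eq (arcK t2) (arcK t2)) eq_sym. Qed.

Let cut_t2 x : cut x -> cut (t2 x) = cup.
Proof.
rewrite /cut => /orP[]/eqP->; first by rewrite (negPf (arc_neq _ _)).
by rewrite (negPf (arc_neq _ _)) orbF cup_ba.
Qed.

Let r_outer x : r (from_outer n x) = Some x.
Proof. by case: x => [i|j] //=; rewrite th_inl. Qed.

Let connect_th x : ~~ cut x -> connect e (inl x) (from_outer n (th x)).
Proof.
case: x => [i|y] nx; first by rewrite th_inl.
have [j -> t1y] := th_inr nx; apply: connect1.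
by have := stack_edge_upper t1 t2 (inl y); rewrite t1y.
Qed.

Let r_connect v x : r v = Some x -> connect e v (from_outer n x).
Proof.
case: v => [y|j] /=; last by move=> [<-].
case: ifPn => [cy|ncy [<-]]; last exact: connect_th.
case: ifPn => // ncup [<-];
  apply: (connect_trans (connect1 (stack_edge_lower t1 t2 y))).
by apply: connect_th; rewrite (cut_t2 cy).
Qed.

Let lower_other x : ~~ cut x -> ~~ cut (t2 x) ->
  reconnect (inr b) (inr a) t2 x = t2 x.
Proof.
rewrite !negb_or => /andP[? ?] /andP[? ?].
by rewrite eE surgery_other //; exact: arcK.
Qed.

Let r_lower x : same_arc t (r (inl x)) (r (inl (t2 x))).
Proof.
rewrite /r; case: ifPn => cx.
  rewrite (cut_t2 cx); case: ifP => //= _; by rewrite eqxx.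
case: ifPn => ctx.
  rewrite -(cut_t2 ctx) arcK (negPf cx) /=; by rewrite eqxx.
by rewrite /= t_th // lower_other // eqxx orbT.
Qed.

Let joined : ~~ cup -> t (th (t2 (inr a))) = th (t2 (inr b)).
Proof.
move=> ncup; have ca : cut (inr a) by rewrite /cut eqxx.
rewrite t_th ?cut_t2 // eE surgeryC surgery_fl ?arc_neq //.
Qed.

Let r_upper y : same_arc t (r (from_upper k y)) (r (from_upper k (t1 y))).
Proof.
have t1_ba : t1 (inl b) = inl a by rewrite -t1_ab arcK.
have cab : cut (inr a) /\ cut (inr b) by rewrite /cut !eqxx orbT.
have through j y' : t1 (inr j) = inl y' ->
  th (inr y') = inr j /\ cut (inr y') = false.
  move=> tj; have ty : t1 (inl y') = inr j by rewrite -tj arcK.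
  have nc : ~~ cut (inr y').
    by apply/negP => /orP[]/eqP[E]; move: ty; rewrite E ?t1_ab ?t1_ba.
  by have [j' ->] := th_inr nc; rewrite ty (negPf nc) => -[->].
case: y => [y|j] /=.
  case: ifPn => cy.
    case/orP: (cy) => /eqP[->]; rewrite ?t1_ab ?t1_ba /= ?(cab.1, cab.2).
      by case: ifPn => //= ncup; rewrite joined // eqxx orbT.
    case: ifPn => //= ncup; rewrite -joined // arcK eqxx orbT //.
  by have [j -> ->] := th_inr cy; rewrite /= eqxx.
case tj: (t1 (inr j)) => [y|j'] /=; last by rewrite (t_top tj) eqxx orbT.
by have [-> ->] := through _ _ tj; rewrite /= eqxx.
Qed.

Let r_arc x : connect e (from_outer n x) (from_outer n (t x)).
Proof.
have AB : connect e (inl (inr a)) (inl (inr b)).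
  by apply: connect1; have := stack_edge_upper t1 t2 (inl a); rewrite t1_ab.
have low y : connect e (inl y) (inl (t2 y)) by
  exact/connect1/(stack_edge_lower t1 t2).
have main y : ~~ cut y ->
  connect e (from_outer n (th y)) (from_outer n (t (th y))).
  move=> ny; rewrite t_th //; have := connect_th ny; rewrite csym => cy.
  apply: connect_trans cy _.
  have [cty|ncty] := boolP (cut (t2 y)); last first.
    rewrite lower_other //; apply: connect_trans (low y) _; exact: connect_th.
  have ncup : ~~ cup by rewrite -(cut_t2 cty) arcK.
  have ca : cut (inr a) by rewrite /cut eqxx.
  have cb : cut (inr b) by rewrite /cut eqxx orbT.
  apply: connect_trans (low y) _; case/orP: cty => /eqP tyE; rewrite tyE.
    have -> : y = t2 (inr a) by rewrite -tyE arcK.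
    rewrite eE surgeryC surgery_fl ?arc_neq //.
    apply: connect_trans AB (connect_trans (low _) _); apply: connect_th.
    by rewrite cut_t2.
  have -> : y = t2 (inr b) by rewrite -tyE arcK.
  rewrite eE surgery_fl ?arc_neq -?cup_ba //.
  rewrite csym in AB.
  apply: connect_trans AB (connect_trans (low _) _); apply: connect_th.
  by rewrite cut_t2.
case: x => [i|j]; first by have := main (inl i); rewrite th_inl; apply.
case tj: (t1 (inr j)) => [y|j'].
  have ty : t1 (inl y) = inr j by rewrite -tj arcK.
  have t1_ba : t1 (inl b) = inl a by rewrite -t1_ab arcK.
  have nc : ~~ cut (inr y).
    by apply/negP => /orP[]/eqP[E]; move: ty; rewrite E ?t1_ab ?t1_ba.
  have := main _ nc; have [j' ->] := th_inr nc; rewrite ty => -[->]; exact.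
rewrite (t_top tj); apply: connect1.
by have := stack_edge_upper t1 t2 (inr j); rewrite tj.
Qed.

Lemma capped_is_stack t' : is_stack t1 t2 t' = (t' == t).
Proof. exact: (retract_is_stack r_outer r_lower r_upper r_arc). Qed.

Lemma capped_closed_circles : closed_circles t1 t2 = cup.
Proof.
have [cupT|ncup] := boolP cup; last first.
  apply: (retract_no_circle r_outer r_connect r_lower r_upper) => -[x|j] //=.
  by case: ifP => //; rewrite (negPf ncup).
rewrite (retract_closed_circles r_outer r_connect r_lower r_upper).
transitivity (n_comp e (connect e (inl (inr a)))); last exact: n_comp_connect.
apply: eq_n_comp_r => v.
rewrite !inE; apply/eqP/idP => [|Av].
  case: v => [x|j] //=; case: ifP => // /orP[]/eqP-> _; first exact: connect0.
  by apply: connect1; have := stack_edge_upper t1 t2 (inl a); rewrite t1_ab.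
have := retract_connect r_lower r_upper Av.
by rewrite /= /cut eqxx /= cupT; case: (r v).
Qed.
End Cap.
End ThroughUpper.

Lemma stack_id k n (t : tangle k n) t' :
  is_stack (id_tangle n) t t' = (t' == t) /\ closed_circles (id_tangle n) t =
    0%N.
Proof.
have top i j : id_tangle n (inr i) = inr j ->
  t (inr i) = inr j by rewrite id_tangleE.
have inr_id (y : 'I_n) : exists2 j,
  (inr y : bpoint k n) = inr j & id_tangle n (inl y) = inr j.
  by exists y; rewrite ?id_tangleE.
split; first exact: (@through_is_stack _ _ _ _ _ _ id).
exact: (@through_closed_circles _ _ _ _ _ t id).
Qed.

Lemma mirror_inl k l (t : tangle k l) i : mirror t (inl i) = swap_pt (t (inr
  i)).
Proof. by rewrite ffunE. Qed.

Lemma mirror_inr k l (t : tangle k l) j : mirror t (inr j) = swap_pt (t (inl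
  j)).
Proof. by rewrite ffunE. Qed.

(** * Stacking with caps, cups and the tangles u_i *)

Section Generators.
Variables (n : nat) (a b : 'I_n).
Hypothesis ab : b = a.+1 :> nat.

Definition tl_surgery k (t : tangle k n) := reconnect (inr b) (inr a) t.

Lemma tl_surgeryE k (t : tangle k n) :
  tl_surgery t =1 surgery (inr b) (inr a) t.
Proof. exact: reconnectE (bpos_top k ab). Qed.

Fact skip_subproof (j : 'I_(n - 2)) : ((if (j < a)%N then j : nat else j.+2) <
  n)%N.
Proof. by have := ltn_ord j; case: ifP; lia. Qed.
Definition skip (j : 'I_(n - 2)) : 'I_n := Ordinal (skip_subproof j).

Definition skip_pt (x : bpoint n (n - 2)) : bpoint n n :=
  match x with inl i => inl i | inr j => inr (skip j) end.

Lemma skip_inj : injective skip.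
Proof.
move=> i j /(congr1 val) /=; case: ifP; case: ifP => *; apply: val_inj => /=;
  lia.
Qed.

Lemma skip_pt_inj : injective skip_pt.
Proof.
move=> [i|i] [j|j] //=; first by move=> [->].
by move=> [E]; congr inr; apply/skip_inj/val_inj.
Qed.

Lemma skip_neq j : (skip j != a) && (skip j != b).
Proof. by rewrite -!(inj_eq val_inj) /= ab; case: ifP; lia. Qed.

Lemma skip_surj (i : 'I_n) : i != a -> i != b -> exists j, i = skip j.
Proof.
rewrite -!(inj_eq val_inj) /= ab => ia ib; have := ltn_ord i;
  have := ltn_ord b => *.
have jn : ((if (i < a)%N then i : nat else i - 2) < n - 2)%N by case: ifP; lia.
exists (Ordinal jn); apply: val_inj => /=; repeat case: ifP; lia.
Qed.

(** The default is taken only at [inr a] and [inr b], the ends of the cap, where the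
    strand-following map of [stack_cap] may have any value. *)
Definition unskip_pt (y : bpoint n n) : bpoint n (n - 2) :=
  odflt (inl a) [pick x | skip_pt x == y].

Lemma skip_ptK : cancel skip_pt unskip_pt.
Proof.
move=> x; rewrite /unskip_pt; case: pickP => [y /eqP/skip_pt_inj //|/(_ x)].
by rewrite eqxx.
Qed.

Lemma skip_pt_neq x : (skip_pt x != inr a) && (skip_pt x != inr b).
Proof. by case: x => //= j; exact: (skip_neq j). Qed.

Lemma unskip_ptK y : y != inr a -> y != inr b -> skip_pt (unskip_pt y) = y.
Proof.
move=> ya yb; suff [x ->] : exists x, y = skip_pt x by rewrite skip_ptK.
case: y ya yb => [i|i] ia ib; first by exists (inl i).
by have [j ->] := skip_surj ia ib; exists (inr j).
Qed.

Lemma bpos_skip x y : (bpos (skip_pt x) < bpos (skip_pt y))%N = (bpos x < bpos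
  y)%N.
Proof.
by case: x y => [i|i] [j|j] /=; have := ltn_ord i; have := ltn_ord j;
  have := ltn_ord a;
  repeat case: ifP; lia.
Qed.

Lemma skip_pt_arc (t : tangle n n) x : t (inr a) = inr b ->
  skip_pt (unskip_pt (t (skip_pt x))) = t (skip_pt x).
Proof.
move=> tab; have tba : t (inr b) = inr a by rewrite -tab arcK.
have /andP[xa xb] := skip_pt_neq x.
by apply: unskip_ptK; rewrite -?tab -?tba (inj_eq (inv_inj (arcK t))) // tba.
Qed.

Fact unskip_subproof (t : tangle n n) :
  is_tangle (finfun (fun x => unskip_pt (tl_surgery t (skip_pt x)))).
Proof.
have tE x : skip_pt (unskip_pt (tl_surgery t (skip_pt x))) = tl_surgery t
  (skip_pt x).
  by apply: skip_pt_arc; rewrite tl_surgeryE surgery_r.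
apply: is_tangle_finfun => [x|x|x y].
- by rewrite tE arcK skip_ptK.
- by rewrite -(inj_eq skip_pt_inj) tE arc_neq.
- by rewrite -!bpos_skip !tE arc_nc.
Qed.
(* The tangle obtained by stacking the cap on t. *)
Definition tl_cap_off (t : tangle n n) : tangle n (n - 2) :=
  MkTangle (unskip_subproof t).

Lemma tl_cap_offE t x : skip_pt (tl_cap_off t x) = tl_surgery t (skip_pt x).
Proof. by rewrite ffunE skip_pt_arc // tl_surgeryE surgery_r. Qed.

(** Capping forgets only the arc between a and b, which every surgered tangle has. This is why a cap
    and its U_i annihilate the same elements. *)
Lemma tl_cap_off_inj t t' : tl_cap_off t = tl_cap_off t' ->
  tl_surgery t = tl_surgery t'.
Proof.
move=> E; apply: tangle_ext => x; rewrite !tl_surgeryE.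
case: (eqVneq x (inr b)) => [->|xb]; first by rewrite !surgery_l.
case: (eqVneq x (inr a)) => [->|xa]; first by rewrite !surgery_r.
by rewrite -!tl_surgeryE -(unskip_ptK xa xb) -!tl_cap_offE E.
Qed.

Definition u_tangle : tangle n n := tl_surgery (id_tangle n).
Definition cap_tangle : tangle n (n - 2) := tl_cap_off (id_tangle n).

Let ba : b != a.
Proof. by rewrite -(inj_eq val_inj) /= ab; lia. Qed.

Lemma u_tangle_inl : u_tangle (inl a) = inl b.
Proof.
rewrite /u_tangle tl_surgeryE -[inl a]/(swap_pt (inr a)) -id_tangleE.
by rewrite surgeryC surgery_fl ?id_tangleE.
Qed.

Lemma u_tangle_through i : i != a -> i != b -> u_tangle (inl i) = inr i.
Proof.
move=> ia ib; rewrite /u_tangle tl_surgeryE surgery_other ?id_tangleE //.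
exact: arcK.
Qed.

Lemma cap_tangle_inl : cap_tangle (inl a) = inl b.
Proof. by apply: skip_pt_inj; rewrite tl_cap_offE /= -u_tangle_inl. Qed.

Lemma cap_tangle_through j : cap_tangle (inl (skip j)) = inr j.
Proof.
have /andP[ja jb] := skip_neq j.
by apply: skip_pt_inj; rewrite tl_cap_offE /= -(u_tangle_through ja jb).
Qed.

Lemma is_capE (t : tangle n (n - 2)) : is_cap a t = (t == cap_tangle).
Proof.
apply/idP/eqP => [/andP[/forallP t_ab /forallP t_thr]|->].
  have tab : t (inl a) = inl b.
    by have /forallP/(_ b) := t_ab a; rewrite ab !eqxx => /eqP.
  have tthr j : t (inl (skip j)) = inr j.
    by have /forallP/(_ (skip j)) := t_thr j; rewrite eqxx => /eqP.
  apply: tangle_ext => -[i|j].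
    case: (eqVneq i a) => [->|ia]; first by rewrite tab cap_tangle_inl.
    case: (eqVneq i b) => [->|ib].
      by rewrite -[in LHS]tab -cap_tangle_inl !arcK.
    by have [j ->] := skip_surj ia ib; rewrite tthr cap_tangle_through.
  by rewrite -[in LHS]tthr -[in RHS]cap_tangle_through !arcK.
apply/andP; split; apply/forallP => x; apply/forallP => y; apply/implyP.
  move=> /andP[/eqP xa /eqP ya].
  have -> : x = a by apply: val_inj.
  have -> : y = b by apply: val_inj; rewrite /= ab.
  by rewrite cap_tangle_inl.
move=> /eqP ya; have -> : y = skip x by apply: val_inj.
by rewrite cap_tangle_through.
Qed.

Lemma stack_u k (t : tangle k n) t' :
  is_stack u_tangle t t' = (t' == tl_surgery t ) /\
  closed_circles u_tangle t = (t (inr a) == inr b).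
Proof.
have top i j : u_tangle (inr i) = inr j -> tl_surgery t (inr i) = inr j.
  rewrite /u_tangle !tl_surgeryE.
  case: (eqVneq i b) => [->|ib]; first by rewrite !surgery_l => -[->].
  case: (eqVneq i a) => [->|ia]; first by rewrite !surgery_r => -[->].
  by rewrite surgery_other ?id_tangleE //; exact: arcK.
have inr_id (y : 'I_n) : ~~ ((inr y == inr a :> bpoint k n) || (inr y == inr b
  :> bpoint k n)) ->
    exists2 j, (inr y : bpoint k n) = inr j & u_tangle (inl y) = inr j.
  rewrite negb_or => /andP[ya yb]; exists y => //; exact: u_tangle_through.
split.
  exact: (@capped_is_stack _ _ _ _ _ _ id _ _ _ _ ab u_tangle_inl).
exact: (@capped_closed_circles _ _ _ _ _ _ id _ top _ _ ab u_tangle_inl).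
Qed.

Lemma stack_cap (t : tangle n n) t' :
  is_stack cap_tangle t t' = (t' == tl_cap_off t ) /\
  closed_circles cap_tangle t = (t (inr a) == inr b).
Proof.
have top i j : cap_tangle (inr i) = inr j -> tl_cap_off t (inr i) = inr j.
  by rewrite -cap_tangle_through arcK.
have inl_id i : unskip_pt (inl i) = inl i by rewrite -[inl i]/(skip_pt (inl
  i)) skip_ptK.
have inr_id (y : 'I_n) : ~~ ((inr y == inr a :> bpoint n n) || (inr y == inr b
  :> bpoint n n)) ->
    exists2 j, unskip_pt (inr y) = inr j & cap_tangle (inl y) = inr j.
  rewrite negb_or => /andP[ya yb]; have [j ->] := skip_surj ya yb.
  exists j; last exact: cap_tangle_through.
  by rewrite -[inr _]/(skip_pt (inr j)) skip_ptK.
have th x : ~~ ((x == inr a) || (x == inr b)) ->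
    tl_cap_off t (unskip_pt x) = unskip_pt (tl_surgery t x).
  rewrite negb_or => /andP[xa xb].
  rewrite -[in RHS](unskip_ptK xa xb) -tl_cap_offE skip_ptK //.
split.
  exact: (@capped_is_stack _ _ _ _ _ _ unskip_pt inl_id top _ _ ab
    cap_tangle_inl).
exact: (@capped_closed_circles _ _ _ _ _ _ unskip_pt inl_id top _ _ ab
  cap_tangle_inl).
Qed.

Lemma stack_cup_cap t' :
  is_stack (mirror cap_tangle) cap_tangle t' = (t' == u_tangle ) /\
  closed_circles (mirror cap_tangle) cap_tangle = 0%N.
Proof.
have inr_sk (y : 'I_(n - 2)) : exists2 j,
  skip_pt (inr y) = inr j & mirror cap_tangle (inl y) = inr j.
  by exists (skip y); rewrite // mirror_inl -cap_tangle_through arcK.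
have th x : u_tangle (skip_pt x) = skip_pt (cap_tangle x) by rewrite
  tl_cap_offE.
have top i j : mirror cap_tangle (inr i) = inr j -> u_tangle (inr i) = inr j.
  rewrite mirror_inr /u_tangle tl_surgeryE.
  case: (eqVneq i b) => [->|ib].
    by rewrite surgery_l -cap_tangle_inl arcK => -[->].
  case: (eqVneq i a) => [->|ia];
    first by rewrite surgery_r cap_tangle_inl => -[->].
  by have [c ->] := skip_surj ia ib; rewrite cap_tangle_through.
split; first exact: (@through_is_stack _ _ _ _ _ _ skip_pt).
exact: (@through_closed_circles _ _ _ _ _ u_tangle skip_pt).
Qed.
End Generators.

(** * The operators U_i and C *)

Section Monomial.
Variables (T : finType) (R : fieldType).
Implicit Types (f g : T -> T) (w : T -> R) (x : {ffun T -> R^o}).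

(** The linear map that sends the basis vector s to [w s] times the basis vector [f s]. *)
Definition monomial_op f w x : {ffun T -> R^o} :=
  [ffun t => \sum_(s | f s == t) x s * w s].

Fact monomial_op_linear f w : linear (monomial_op f w).
Proof.
move=> k x y; apply/ffunP => t; rewrite !ffunE scaler_sumr -big_split.
by apply: eq_bigr => s _; rewrite !ffunE mulrDl scalerAl.
Qed.
HB.instance Definition _ f w := GRing.isLinear.Build R {ffun T -> R^o}
  {ffun T -> R^o} _ (monomial_op f w) (monomial_op_linear f w).

Lemma monomial_op_comp f g v w x :
  monomial_op f v (monomial_op g w x) =
  monomial_op (f \o g) (fun s => w s * v (g s)) x.
Proof.
apply/ffunP => t; rewrite !ffunE.
under eq_bigr => s _ do rewrite ffunE big_distrl /=.
rewrite (exchange_big_dep (fun s => f (g s) == t)) /= =>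
  [|s r /eqP <- /eqP-> //].
apply: eq_bigr => s /eqP fgs; rewrite (big_pred1 (g s)) ?mulrA // => r /=.
rewrite [r == _]eq_sym; case: (eqVneq (g s) r) => [<-|_]; last by rewrite andbF.
by rewrite fgs eqxx.
Qed.

Lemma eq_monomial_op f g v w x : f =1 g -> v =1 w ->
  monomial_op f v x = monomial_op g w x.
Proof.
move=> fg vw; apply/ffunP => t; rewrite !ffunE.
by apply: eq_big => [s|s _]; rewrite ?fg ?vw.
Qed.

Lemma monomial_op_scale f w k x :
  k *: monomial_op f w x = monomial_op f (fun s => k * w s) x.
Proof.
apply/ffunP => t; rewrite !ffunE scaler_sumr; apply: eq_bigr => s _.
by rewrite mulrCA.
Qed.
End Monomial.

Lemma map_monomial_op (T : finType) (R S : fieldType) (phi : {rmorphism R -> S})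
    (f : T -> T) (w : T -> R) (x : {ffun T -> R^o}) :
  monomial_op f (phi \o w) [ffun t => phi (x t)] =
  [ffun t => phi (monomial_op f w x t)] :> {ffun T -> S^o}.
Proof.
apply/ffunP => t; rewrite !ffunE rmorph_sum; apply: eq_bigr => s _.
by rewrite ffunE rmorphM.
Qed.

(* The combinatorial data of the left action of u_0, ..., u_(n-1) on tangles:
   u_i s = (-q - q^-1)^(c i s) (e i s), where o is the identity tangle. *)
Record tl_action (T : finType) (o : T) (n : nat)
    (e : nat -> T -> T) (c : nat -> T -> bool) : Prop := TLAction {
  tla_cup : forall i s, (i < n)%N -> c i (e i s);
  tla_id : forall i s, (i < n)%N -> c i s -> e i s = s;
  tla_nbr_cup : forall i j s, (i < n)%N -> (j < n)%N ->
    (i == j.+1) || (j == i.+1) -> c j (e i s) = false;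
  tla_nbr : forall i j s, (i < n)%N -> (j < n)%N ->
    (i == j.+1) || (j == i.+1) -> e i (e j (e i s)) = e i s;
  tla_far : forall i j s, (i.+1 < j)%N -> (j < n)%N ->
    e i (e j s) = e j (e i s);
  tla_far_cup : forall i j s, (i.+1 < j)%N -> (j < n)%N ->
    (c j s + c i (e j s) = c i s + c j (e i s))%N;
  tla_o : forall i, (i < n)%N -> c i o = false;
  tla_nonid : forall s, s != o -> exists2 i, (i < n)%N & c i s }.

Section Action.
Variables (T : finType) (o : T) (n : nat).
Variables (e : nat -> T -> T) (c : nat -> T -> bool).
Hypothesis tla : tl_action o n e c.

Section Ring.
Variables (R : fieldType) (q : R).
Hypothesis q0 : q != 0.
Local Notation V := {ffun T -> R^o}.
Let delta : R := - (q + q^-1).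

Definition Uop i : V -> V := monomial_op (e i) (fun s => delta ^+ c i s).
HB.instance Definition _ i := GRing.Linear.on (Uop i).

(* q^(1/2) times the bracket of the i-th elementary braid. *)
Definition Aop i (x : V) : V := x + q *: Uop i x.
Fact Aop_linear i : linear (Aop i).
Proof.
move=> k x y; rewrite /Aop linearP scalerDr !scalerA [q * k]mulrC -scalerA
  scalerDr.
by rewrite addrACA.
Qed.
HB.instance Definition _ i :=
  GRing.isLinear.Build R V V _ (Aop i) (Aop_linear i).

Definition Aword (w : seq nat) (x : V) : V := foldr Aop x w.
Fact Aword_linear w : linear (Aword w).
Proof. by move=> k x y; elim: w => //= i w ->; rewrite linearP. Qed.
HB.instance Definition _ w :=
  GRing.isLinear.Build R V V _ (Aword w) (Aword_linear w).

Definition Cop := Aword (iota 0 n).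
HB.instance Definition _ := GRing.Linear.on Cop.

Lemma Uop_far i j x : (i.+1 < j)%N -> (j < n)%N ->
  Uop i (Uop j x) = Uop j (Uop i x).
Proof.
move=> ij jn; rewrite /Uop !monomial_op_comp; apply: eq_monomial_op => s /=.
  exact: (tla_far tla).
by rewrite -!exprD (tla_far_cup tla).
Qed.

Lemma Uop_sqr i x : (i < n)%N -> Uop i (Uop i x) = delta *: Uop i x.
Proof.
move=> i_n; rewrite /Uop monomial_op_comp monomial_op_scale.
apply: eq_monomial_op => s /=; first by rewrite (tla_id tla) ?(tla_cup tla).
by rewrite (tla_cup tla) // mulrC.
Qed.

Lemma Uop_nbr i j x : (i < n)%N -> (j < n)%N -> (i == j.+1) || (j == i.+1) ->
  Uop i (Uop j (Uop i x)) = Uop i x.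
Proof.
move=> i_n jn ij; rewrite /Uop !monomial_op_comp; apply: eq_monomial_op => s /=.
  exact: (tla_nbr tla).
rewrite !(tla_nbr_cup tla) // ?mulr1 //; by rewrite orbC.
Qed.

Lemma Uop_Aop_far i j x : (i.+1 < j)%N || (j.+1 < i)%N -> (i < n)%N ->
  (j < n)%N ->
  Uop i (Aop j x) = Aop j (Uop i x).
Proof.
move=> ij i_n jn; rewrite /Aop linearD linearZ /=; congr (_ + _ *: _).
by case/orP: ij => ij; [|symmetry]; apply: Uop_far.
Qed.

(** Both sides equal q U_(i+1) U_i: the remaining terms are multiples of 1 + q delta + q^2 = 0.
    Topologically, a cup slides through a pair of crossings. *)
Lemma Aop_Aop_Uop i x : (i.+1 < n)%N ->
  Aop i (Aop i.+1 (Uop i x)) = Uop i.+1 (Aop i (Aop i.+1 x)).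
Proof.
move=> i_n; have i_n' : (i < n)%N by lia.
rewrite /Aop !(linearD, linearZ) /= !Uop_sqr // !Uop_nbr ?eqxx ?orbT //.
have qq : 1 + q * delta + q * q = 0.
  by rewrite /delta mulrN mulrDr mulfV //; ring.
move: (Uop i.+1 (Uop i x)) (Uop i x) (Uop i.+1 x) => u y z.
apply/eqP; rewrite -subr_eq0; apply/eqP/ffunP => t;
  rewrite !ffunE /GRing.scale /=.
transitivity ((1 + q * delta + q * q) * (y t - z t)); first by ring.
by rewrite qq mul0r.
Qed.

Lemma Aword_cat w w' x : Aword (w ++ w') x = Aword w (Aword w' x).
Proof. by rewrite /Aword foldr_cat. Qed.

Lemma Uop_Aword_far i w x : (i < n)%N ->
  {in w, forall j, (j < n)%N && ((i.+1 < j)%N || (j.+1 < i)%N)} ->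
  Uop i (Aword w x) = Aword w (Uop i x).
Proof.
move=> i_n; elim: w => //= j w IH wP.
have /andP[jn ij] := wP j (mem_head j w).
rewrite Uop_Aop_far // IH // => k kw; apply: wP; by rewrite inE kw orbT.
Qed.

Lemma Cop_Uop i x : (i.+1 < n)%N -> Cop (Uop i x) = Uop i.+1 (Cop x).
Proof.
(* The word is cut around the letters i and i + 1: the earlier letters commute with U_(i+1), the
   later ones with U_i. *)
move=> i_n; rewrite /Cop (_ : n = (i + (n - i.+2).+2)%N); last lia.
rewrite iotaD add0n /= !Aword_cat /= -Uop_Aword_far; last 2 first.
- lia.
- by move=> j; rewrite mem_iota; lia.
rewrite Aop_Aop_Uop // Uop_Aword_far // => j; rewrite mem_iota; lia.
Qed.

(* Modulo q, [Aop i] is the projection that kills the tangles with a cup at i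
   and fixes the others. *)
Lemma AopE i x t : (i < n)%N ->
  Aop i x t = if c i t
              then - q ^+ 2 * x t + q * \sum_(s | (e i s == t) && ~~ c i s) x s
              else x t.
Proof.
move=> i_n; rewrite !ffunE /GRing.scale /= (bigID (c i)) /=; case: ifPn => ct.
  (* A preimage of t with a cup at i is fixed by [e i], hence is t itself. It contributes q delta =
     - q^2 - 1, and the - 1 cancels the identity term of [Aop]. *)
  rewrite (big_pred1 t) => [|s]; last first.
    by case: (boolP (c i s)) => cs; rewrite ?andbF ?andbT ?(tla_id tla) //=;
      apply/esym/eqP => st; rewrite st ct in cs.
  rewrite [X in _ + q * (_ + X)](eq_bigr x) => [|s /andP[_ /negPf->]];
    last first.
    by rewrite mulr1.
  rewrite ct expr1 mulrDr addrA; congr (_ + _).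
  have qq : q * delta = - q ^+ 2 - 1 by rewrite /delta mulrN mulrDr mulfV //;
    ring.
  by rewrite mulrCA qq; ring.
rewrite !big_pred0 ?addr0 ?mulr0 ?addr0 // => s; apply/negbTE; apply: contra ct.
  by move=> /andP[/eqP<- _]; exact: (tla_cup tla).
by move=> /andP[/eqP<- _]; exact: (tla_cup tla).
Qed.

Lemma Aop_o i x : (i < n)%N -> Aop i x o = x o.
Proof. by move=> i_n; rewrite AopE // (tla_o tla). Qed.

Lemma Cop_o x : Cop x o = x o.
Proof.
rewrite /Cop; have: {in iota 0 n, forall i, (i < n)%N} by move=> i;
  rewrite mem_iota.
elim: (iota 0 n) => //= i w IH wn; rewrite Aop_o ?wn ?mem_head // IH // => j jw.
by apply: wn; rewrite inE jw orbT.
Qed.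

Lemma Uop_o i x : (i < n)%N -> Uop i x o = 0.
Proof.
move=> i_n; rewrite ffunE big_pred0 // => s; apply/eqP => E.
by have := tla_cup tla s i_n; rewrite E (tla_o tla).
Qed.

Lemma Cop_fixed x : (forall i, (i < n)%N -> Uop i x = 0) -> Cop x = x.
Proof.
move=> Ux; rewrite /Cop.
have: {in iota 0 n, forall i, (i < n)%N} by move=> i; rewrite mem_iota.
elim: (iota 0 n) => //= i w IH wn; rewrite IH => [|j jw]; last first.
  by apply: wn; rewrite inE jw orbT.
by rewrite /Aop Ux ?scaler0 ?addr0 // wn ?mem_head.
Qed.

Lemma Uop_iter i x : (i < n)%N -> Cop x = x -> Uop i x = iter i Cop (Uop 0 x).
Proof.
move=> i_n Cx; elim: i i_n => //= i IH i_n.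
by rewrite -IH ?Cop_Uop ?Cx //; lia.
Qed.

(* With y_i = U_i x, expanding A_0 ... A_(n-1) x = x gives
   sum_i A_0 ... A_(i-1) y_i = 0. *)
Lemma Cop_fixed_sum x : Cop x = x ->
  \sum_(i < n) Aword (iota 0 i) (Uop i x) = 0.
Proof.
have Cn m : Aword (iota 0 m) x =
    x + q *: \sum_(i < m) Aword (iota 0 i) (Uop i x).
  elim: m => [|m IH]; first by rewrite big_ord0 scaler0 addr0.
  rewrite -addn1 iotaD Aword_cat /= {1}/Aop linearD linearZ /= add0n IH.
  by rewrite addn1 big_ord_recr /= scalerDr addrA.
rewrite /Cop Cn => /eqP; rewrite -subr_eq0 addrC addKr scaler_eq0 (negPf q0).
by move=> /eqP.
Qed.
End Ring.
End Action.

(** * Contraction over Laurent series *)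

Section LaurentOrder.
Variable F : fieldType.
Implicit Types (f g : laurent F) (N M : int).

Definition order_ge N f := forall j, j < N -> f j = 0.

Lemma order_geD N f g : order_ge N f -> order_ge N g -> order_ge N (f + g).
Proof. by move=> fN gN j jN; rewrite /= fN // gN // addr0. Qed.

Lemma order_geN N f : order_ge N f -> order_ge N (- f).
Proof. by move=> fN j jN; rewrite /= fN // oppr0. Qed.

Lemma order_geM N M f g : order_ge N f -> order_ge M g ->
  order_ge (N + M) (f * g).
Proof.
move=> fN gM j jNM; rewrite [LHS](_ : _ = lmul f g j) //.
by rewrite (@lmulE _ f g N M j N 0) ?big_ord0 //; lia.
Qed.

Lemma order_ge_sum N (I : Type) (r : seq I) (P : pred I) (f : I -> laurent F) :
  (forall i, P i -> order_ge N (f i)) -> order_ge N (\sum_(i <- r | P i) f i).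
Proof.
by move=> fN; elim/big_rec: _ => // i g Pi gN; apply: order_geD (fN i Pi) gN.
Qed.

Lemma order_ge_trans N M f : M <= N -> order_ge N f -> order_ge M f.
Proof. by move=> MN fN j jM; apply: fN; apply: lt_le_trans MN. Qed.

Lemma order_ge_exists f : exists N, order_ge N f.
Proof. exact: lcoef_bounded. Qed.

Lemma order_ge_monom i : order_ge i (lmonom F i).
Proof. by move=> j ji /=; rewrite lt_eqF. Qed.

Lemma lmonomM i j : lmonom F i * lmonom F j = lmonom F (i + j).
Proof.
apply: laurentP => k;
  rewrite [LHS](_ : _ = lmul (lmonom F i) (lmonom F j) k) //.
have [kij|kij] := ltP k (i + j).
  by have := order_geM (@order_ge_monom i) (@order_ge_monom j) kij => /= ->;
    rewrite lt_eqF.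
rewrite (@lmulE _ _ _ i j k i `|(k - i - j)%R|.+1) //;
  try exact: order_ge_monom.
  rewrite big_ord_recl big1 /= => [|s _]; last first.
    by rewrite (_ : (_ == i) = false) ?mul0r //; apply/eqP; rewrite /bump /=;
      lia.
  rewrite !addr0 eqxx mul1r; congr (_%:R); lia.
lia.
Qed.

Lemma lmonomX i (m : nat) : lmonom F i ^+ m = lmonom F (i * m%:Z).
Proof.
elim: m => [|m IH]; first by rewrite mulr0.
by rewrite exprS IH lmonomM; congr lmonom; lia.
Qed.
End LaurentOrder.

Definition laurent_field (F : fieldType) : fieldType := laurent F.

Section LaurentAction.
Variables (T : finType) (o : T) (n : nat).
Variables (e : nat -> T -> T) (c : nat -> T -> bool).
Hypothesis tla : tl_action o n e c.
Variables (F : fieldType) (q : laurent_field F).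
Hypothesis q0 : q != 0.
Hypothesis q1 : order_ge 1 q.
Local Notation V := {ffun T -> (laurent_field F)^o}.
Local Notation A := (Aop e c q).
Local Notation U := (Uop e c q).
Local Notation C := (Cop n e c q).

Definition vorder_ge N (x : V) := forall t, order_ge N (x t).

Lemma vorder_geD N x y : vorder_ge N x -> vorder_ge N y -> vorder_ge N (x + y).
Proof. by move=> xN yN t; rewrite ffunE; apply: order_geD. Qed.

Lemma vorder_ge_trans N M x : M <= N -> vorder_ge N x -> vorder_ge M x.
Proof. by move=> MN xN t; apply: order_ge_trans MN (xN t). Qed.

Lemma vorder_ge_sum N (I : Type) (r : seq I) (P : pred I) (f : I -> V) :
  (forall i, P i -> vorder_ge N (f i)) -> vorder_ge N (\sum_(i <- r | P i) f i).
Proof.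
move=> fN; elim/big_rec: _ => [t|i g Pi gN]; first by rewrite ffunE.
exact: vorder_geD (fN i Pi) gN.
Qed.

Lemma vorder_ge_exists x : exists N, vorder_ge N x.
Proof.
have [N NP] := choice (fun t => order_ge_exists (x t)).
(* A crude common lower bound of the finitely many [N t]. *)
exists (- \sum_t `|N t|) => t; apply: order_ge_trans (NP t).
apply: (@le_trans _ _ (- `|N t|)); last exact: lerNnormlW (lexx _).
by rewrite lerN2 (bigD1 t) //= lerDl sumr_ge0.
Qed.

Lemma Aop_order N i x t : (i < n)%N -> c i t -> vorder_ge N x ->
  order_ge (N + 1) (A i x t).
Proof.
move=> i_n ct xN; rewrite (AopE tla) // ct mulNr expr2 -mulrA.
have qx f : order_ge N f -> order_ge (N + 1) (q * f).
  by move=> fN; rewrite addrC; apply: order_geM.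
apply: order_geD; last by apply: qx; apply: order_ge_sum => s _.
apply: order_geN; apply: (@order_ge_trans _ (1 + (N + 1))); first lia.
by apply: order_geM => //; apply: qx.
Qed.

(** The gain at t is not lost to letters applied later: such a letter either has a cup at t, and
    then gains anew from order N, or leaves the coefficient of t unchanged. No ordering of the
    tangles is needed. *)
Lemma Aword_order N w x : {in w, forall i, (i < n)%N} -> vorder_ge N x ->
  vorder_ge N (Aword e c q w x) /\
  forall t, has (c^~ t) w -> order_ge (N + 1) (Aword e c q w x t).
Proof.
move=> + xN; elim: w => //= i w IH wn.
have i_n := wn i (mem_head i w).
have wn' : {in w, forall j, (j < n)%N} by move=> j jw;
  rewrite wn // inE jw orbT.
have [wN wN1] := IH wn'.
have Ai t : c i t -> order_ge (N + 1) (A i (Aword e c q w x) t) by move=> ?;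
  apply: Aop_order.
split=> t.
  have [/Ai|ct] := boolP (c i t); first by apply: order_ge_trans; lia.
  by rewrite (AopE tla) // (negPf ct).
have [/Ai//|ct /=] := boolP (c i t); rewrite (AopE tla) // (negPf ct);
  exact: wN1.
Qed.

Lemma Cop_order N x : vorder_ge N x -> x o = 0 -> vorder_ge (N + 1) (C x).
Proof.
move=> xN xo t; have [-> |to] := eqVneq t o; first by rewrite (Cop_o tla) // xo.
have n_iota : {in iota 0 n, forall i, (i < n)%N} by move=> i; rewrite mem_iota.
have [_ ] := Aword_order n_iota xN; apply; apply/hasP.
by have [i i_n ci] := tla_nonid tla to; exists i; rewrite ?mem_iota.
Qed.

Lemma iter_CopB k x y : iter k C (x - y) = iter k C x - iter k C y.
Proof. by elim: k => //= k ->; rewrite linearB. Qed.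

Lemma iter_Cop_o k x : iter k C x o = x o.
Proof. by elim: k => //= k IH; rewrite (Cop_o tla). Qed.

Lemma iter_Cop_order N k x : vorder_ge N x -> x o = 0 ->
  vorder_ge (N + k%:Z) (iter k C x).
Proof.
move=> xN xo; elim: k => [|k IH] /=; first by rewrite addr0.
rewrite (_ : N + k.+1%:Z = N + k%:Z + 1); last lia.
by apply: Cop_order; rewrite ?iter_Cop_o.
Qed.

Lemma vorder_eq0 x : (forall N, vorder_ge N x -> vorder_ge (N + 1) x) -> x = 0.
Proof.
move=> xS; have [N xN] := vorder_ge_exists x.
have xNk (k : nat) : vorder_ge (N + k%:Z) x.
  elim: k => [|k IH]; first by rewrite addr0.
  by rewrite (_ : N + k.+1%:Z = N + k%:Z + 1); [apply: xS|lia].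
apply/ffunP => t; rewrite ffunE; apply: laurentP => j /=.
by apply: (xNk `|(j - N)%R|.+1); lia.
Qed.

Lemma Cop_fixed_eq0 x : C x = x -> x o = 0 -> x = 0.
Proof.
by move=> Cx xo; apply: vorder_eq0 => N xN; rewrite -Cx; apply: Cop_order.
Qed.

(* The relation [Cop_fixed_sum], written in terms of y = U_0 x, is of the form
   y = (an operator of positive order) y. *)
Lemma Cop_fixed_Uop x i : C x = x -> (i < n)%N -> U i x = 0.
Proof.
move=> Cx i_n; rewrite (Uop_iter tla q0) //.
have n0 : (0 < n)%N by lia.
set y := U 0 x; have yo : y o = 0 by rewrite (Uop_o tla).
suff -> : y = 0 by elim: i {i_n} => //= i ->; rewrite linear0.
have /eqP := Cop_fixed_sum q0 Cx.
rewrite (bigD1 (Ordinal n0)) //= -/y addr_eq0 => /eqP yE.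
apply: vorder_eq0 => N yN; rewrite yE => t; rewrite ffunE; apply: order_geN.
move: t; apply: vorder_ge_sum => j j0.
have jw : {in iota 0 j, forall k, (k < n)%N}.
  by move=> k; rewrite mem_iota; have := ltn_ord j; lia.
apply: (Aword_order jw _).1; rewrite (Uop_iter tla q0) // -/y.
apply: (@vorder_ge_trans (N + j%:Z)); last exact: iter_Cop_order.
by move: j0; rewrite -(inj_eq val_inj) /=; lia.
Qed.
End LaurentAction.

(** * The common kernel of the U_i over a field embedded into Laurent series *)

Section Existence.
Variables (T : finType) (o : T) (n : nat).
Variables (e : nat -> T -> T) (c : nat -> T -> bool).
Hypothesis tla : tl_action o n e c.
Variables (R : fieldType) (q : R) (F : fieldType) (phi : {rmorphism R ->
  laurent_field F}).
Hypothesis q0 : q != 0.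
Hypothesis phi_q : order_ge 1 (phi q).
Local Notation V := {ffun T -> R^o}.
Local Notation U := (Uop e c q).
Local Notation C := (Cop n e c q).

Definition vmap (x : V) : {ffun T ->
  (laurent_field F)^o} := [ffun t => phi (x t)].

Lemma vmap_eq0 x : vmap x = 0 -> x = 0.
Proof.
move=> /ffunP x0; apply/ffunP => t; have /eqP := x0 t.
by rewrite !ffunE fmorph_eq0 => /eqP.
Qed.

Lemma Uop_vmap i x : Uop e c (phi q) i (vmap x) = vmap (U i x).
Proof.
rewrite /vmap /Uop -map_monomial_op; apply: eq_monomial_op => s //=.
by rewrite rmorphXn rmorphN rmorphD fmorphV.
Qed.

Lemma Cop_vmap x : Cop n e c (phi q) (vmap x) = vmap (C x).
Proof.
rewrite /Cop; elim: (iota 0 n) => //= i w ->; rewrite {1}/Aop Uop_vmap.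
by apply/ffunP => t; rewrite !ffunE /GRing.scale /= rmorphD rmorphM.
Qed.

Let phi_q0 : phi q != 0. Proof. by rewrite fmorph_eq0. Qed.

Lemma common_kernel_eq0 x : (forall i, (i < n)%N -> U i x = 0) -> x o = 0 ->
  x = 0.
Proof.
move=> Ux xo; apply: vmap_eq0; apply: (Cop_fixed_eq0 tla phi_q0 phi_q).
  by rewrite Cop_vmap (Cop_fixed Ux).
by rewrite ffunE xo rmorph0.
Qed.

Lemma common_kernel_exists :
  exists x : V, x o = 1 /\ forall i, (i < n)%N -> U i x = 0.
Proof.
pose d : V := [ffun t => (t == o)%:R].
(* C - 1 is not injective: its values have no identity component. The rank-one term restores that
   component, so [psi] can be inverted on the whole space, and psi x = d encodes both x o = 1 and C
   x = x. *)
pose psi (x : V) : V := C x - x + x o *: d.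
have psi_lin : linear psi.
  move=> k x y; rewrite /psi linearP; apply/ffunP => t;
    rewrite !ffunE /GRing.scale /=; ring.
pose HL := GRing.isLinear.Build R V V _ psi psi_lin.
pose L : {linear V -> V} := HB.pack psi HL.
have psi_o x : psi x o = x o.
  by rewrite !ffunE (Cop_o tla q0) subrr add0r eqxx /GRing.scale /= mulr1.
have inj : lker (linfun L) == 0%VS.
  apply/lker0P => x y; rewrite !lfunE /= => /eqP;
    rewrite -subr_eq0 -[psi x - psi y](linearB L).
  set z := x - y => /eqP z0; apply/eqP; rewrite -subr_eq0 -/z; apply/eqP.
  have zo : z o = 0 by rewrite -psi_o [psi z]z0 ffunE.
  (* An element of the kernel is fixed by C and has no identity component; the contraction kills its
     image in Laurent series. *)
  apply: vmap_eq0; apply: (Cop_fixed_eq0 tla phi_q0 phi_q);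
    last by rewrite ffunE zo rmorph0.
  rewrite Cop_vmap; congr vmap; apply/eqP; rewrite -subr_eq0 -z0 /= /psi zo.
  by rewrite scale0r addr0.
pose x := ((linfun L)^-1 d)%VF.
have psi_x : psi x = d by have := lker0_lfunVK inj d; rewrite lfunE.
have xo : x o = 1 by rewrite -psi_o psi_x ffunE eqxx.
have Cx : C x = x.
  have : C x - x + d = 0 + d by rewrite add0r -[RHS]psi_x /psi xo scale1r.
  by move/addIr/eqP; rewrite subr_eq0 => /eqP.
exists x; split=> // i i_n; apply: vmap_eq0; rewrite -Uop_vmap.
by apply: (Cop_fixed_Uop tla phi_q0 phi_q) => //; rewrite Cop_vmap Cx.
Qed.
End Existence.

(** * Tangles and the Jones-Wenzl projector *)

Section TangleAction.
Variable n : nat.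
Local Notation N := n.+1.
Implicit Types (s t : tangle N N) (i j : nat).

Definition top i : bpoint N N := inr (inord i).
Definition act i t : tangle N N := tl_surgery (inord i) (inord i.+1) t.
Definition has_cup i t : bool := t (top i) == top i.+1.

Lemma topE (a : 'I_N) : top a = inr a.
Proof. by rewrite /top inord_val. Qed.

Lemma inordS i : (i < n)%N -> (inord i.+1 : 'I_N) = (inord i : 'I_N).+1 :> nat.
Proof. by move=> i_n; rewrite !inordK //; lia. Qed.

Lemma has_cupC i t : has_cup i t = (t (top i.+1) == top i).
Proof. by rewrite /has_cup (can2_eq (arcK t) (arcK t)) eq_sym. Qed.

Lemma eq_top i j : (i <= n)%N -> (j <= n)%N -> (top i == top j) = (i == j).
Proof.
move=> i_n jn; rewrite (inj_eq (@inr_inj _ _)).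
by rewrite -(inj_eq val_inj) /= !inordK.
Qed.

Lemma actE i t : (i < n)%N -> act i t =1 surgery (top i) (top i.+1) t.
Proof. by move=> i_n x; rewrite /act tl_surgeryE ?inordS // surgeryC. Qed.

Lemma actE' i t : (i < n)%N -> act i t =1 surgery (top i.+1) (top i) t.
Proof. by move=> i_n x; rewrite actE // surgeryC. Qed.

Lemma act_nbr i j s : (i < n)%N -> (j < n)%N -> (i == j.+1) || (j == i.+1) ->
  act i (act j (act i s)) = act i s.
Proof.
move=> i_n jn ij; apply: tangle_ext => x.
case/orP: ij => /eqP ijE.
  rewrite ijE in i_n *.
  rewrite actE' // (eq_surgery _ _ (actE' _ jn)) (eq_surgery _ _ (eq_surgery _
    _ (actE' s i_n))).
  rewrite surgery_braid -?actE' //; first exact: arcK.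
  by rewrite /= !inE !eq_top; lia.
rewrite ijE in jn *.
rewrite actE // (eq_surgery _ _ (actE _ jn)) (eq_surgery _ _ (eq_surgery _ _
  (actE s i_n))).
rewrite surgery_braid -?actE //; first exact: arcK.
by rewrite /= !inE !eq_top; lia.
Qed.

Lemma tops_uniq i j : (i.+1 < j)%N -> (j < n)%N ->
  uniq [:: top i; top i.+1; top j; top j.+1].
Proof. by move=> ij jn; rewrite /= !inE !eq_top; lia. Qed.

Lemma act_far i j s : (i.+1 < j)%N -> (j < n)%N ->
  act i (act j s) = act j (act i s).
Proof.
move=> ij jn; have i_n : (i < n)%N by lia.
apply: tangle_ext => x.
apply: etrans (actE (act j s) i_n x) _.
apply: etrans _ (esym (actE (act i s) jn x)).
apply: etrans (eq_surgery _ _ (actE s jn) x) _.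
apply: etrans _ (esym (eq_surgery _ _ (actE s i_n) x)).
exact: surgery_comm (@arcK _ _ s) (@arc_neq _ _ s) (tops_uniq ij jn) x.
Qed.

Lemma tangle_tl_action : tl_action (id_tangle N) n act has_cup.
Proof.
split.
- by move=> i s i_n; rewrite /has_cup actE // surgery_l.
- move=> i s i_n /eqP si; apply: tangle_ext => x; rewrite actE //.
  exact: surgery_id (arcK s) si x.
- move=> i j s i_n jn /orP[]/eqP ijE; subst.
    by rewrite has_cupC actE // surgery_l eq_top; lia.
  by rewrite /has_cup actE // surgery_r eq_top; lia.
- exact: act_nbr.
- exact: act_far.
- move=> i j s ij jn; have i_n : (i < n)%N by lia.
  have := surgery_comm_cups (@arcK _ _ s) (@arc_neq _ _ s) (tops_uniq ij jn).
  have <- := actE s jn (top i); have <- := actE s i_n (top j); exact.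
- by move=> i i_n; rewrite /has_cup id_tangleE.
- move=> s; rewrite -is_idE => /not_id_top_arc[a [b [ab sab]]].
  have i_n : (a < n)%N by have := ltn_ord b; lia.
  by exists a => //; rewrite /has_cup -ab !topE sab.
Qed.
End TangleAction.

(** * Composition of elements, and the projector as a common kernel *)

Section TLComposition.
Variables (R : fieldType) (q : R).
Local Notation delta := (- (q + q^-1)).

Definition tl_single k l (t : tangle k l) : TL R k l := [ffun s => (s == t)%:R].

Definition tangle_comp k l m (t1 : tangle l m) (y : TL R k l) : TL R k m :=
  [ffun t => \sum_(t2 : tangle k l | is_stack t1 t2 t)
               y t2 * delta ^+ closed_circles t1 t2].

Lemma tl_compE k l m (x : TL R l m) (y : TL R k l) :
  tl_comp q x y = \sum_t1 x t1 *: tangle_comp t1 y.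
Proof.
apply/ffunP => t; rewrite sum_ffunE ffunE; apply: eq_bigr => t1 _.
rewrite !ffunE scaler_sumr; apply: eq_bigr => t2 _; by rewrite -mulrA.
Qed.

Lemma tl_single_comp k l m (t1 : tangle l m) (y : TL R k l) :
  tl_comp q (tl_single t1) y = tangle_comp t1 y.
Proof.
rewrite tl_compE (bigD1 t1) //= ffunE eqxx scale1r big1 ?addr0 // => s st.
by rewrite ffunE (negPf st) scale0r.
Qed.

Lemma tangle_comp_single k l m (t1 : tangle l m) (t2 : tangle k l) t c :
  (forall t', is_stack t1 t2 t' = (t' == t)) -> closed_circles t1 t2 = c ->
  tangle_comp t1 (tl_single t2) = delta ^+ c *: tl_single t.
Proof.
move=> st cc; apply/ffunP => s; rewrite !ffunE.
have [->|ns] := eqVneq s t.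
  rewrite (bigD1 t2) ?st ?eqxx //= big1 => [|t3 /andP[_ /negPf t3P]].
    by rewrite ffunE eqxx mul1r cc addr0 /GRing.scale /= mulr1.
  by rewrite ffunE t3P mul0r.
rewrite big1 ?scaler0 // => t3 t3P; rewrite ffunE.
by case: eqP t3P => [->|_ _]; rewrite ?mul0r // st (negPf ns).
Qed.

Lemma tangle_compE k l m (t1 : tangle l m) (f : tangle k l -> tangle k m)
    (c : tangle k l -> nat) (y : TL R k l) t :
  (forall t2 t', is_stack t1 t2 t' = (t' == f t2)) ->
  (forall t2, closed_circles t1 t2 = c t2) ->
  tangle_comp t1 y t = \sum_(s | f s == t) y s * delta ^+ c s.
Proof.
move=> st cc; rewrite ffunE.
by apply: eq_big => [s|s _]; rewrite ?st 1?eq_sym ?cc.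
Qed.

Lemma tl_idE n : tl_id R n = tl_single (id_tangle n).
Proof. by apply/ffunP => t; rewrite !ffunE -is_idE. Qed.

Lemma tangle_comp_id k n (y : TL R k n) : tangle_comp (id_tangle n) y = y.
Proof.
apply/ffunP => t; rewrite (@tangle_compE _ _ _ _ id (fun=> 0%N)).
- by rewrite big_pred1_eq mulr1.
- by move=> t2 t'; case: (stack_id t2 t').
- by move=> t2; case: (stack_id t2 t2).
Qed.

Section Strands.
Variable n : nat.
Local Notation N := n.+1.
Local Notation U := (Uop (act (n := n)) (has_cup (n := n)) q).
Implicit Types (x : TL R N N) (i : nat).

Lemma tl_capE i (i_n : (i < n)%N) :
  tl_cap R N i = tl_single (cap_tangle (inordS i_n)).
Proof.
apply/ffunP => t; rewrite !ffunE -is_capE; congr (is_cap _ _)%:R.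
by rewrite inordK //; lia.
Qed.

Lemma mirrorK k l : cancel (@mirror k l) (@mirror l k).
Proof. by move=> t; apply: tangle_ext => x; rewrite !ffunE !swap_ptK. Qed.

Lemma tl_cupE i (i_n : (i < n)%N) :
  tl_cup R N i = tl_single (mirror (cap_tangle (inordS i_n))).
Proof.
apply/ffunP => t; rewrite !ffunE -(can_eq (@mirrorK _ _)) mirrorK -is_capE.
by congr (is_cap _ _)%:R; rewrite inordK //; lia.
Qed.

Lemma tl_UE i : (i < n)%N ->
  tl_U q N i = tl_single (u_tangle (inord i : 'I_N) (inord i.+1)).
Proof.
move=> i_n; rewrite /tl_U (tl_capE i_n) (tl_cupE i_n) tl_single_comp.
rewrite (@tangle_comp_single _ _ _ _ _ (u_tangle (inord i : 'I_N) (inord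
  i.+1)) 0).
- by rewrite expr0 scale1r.
- by move=> t'; case: (stack_cup_cap (inordS i_n) t').
- by case: (stack_cup_cap (inordS i_n) (id_tangle _)).
Qed.

Lemma tl_comp_U i x : (i < n)%N -> tl_comp q (tl_U q N i) x = U i x.
Proof.
move=> i_n; rewrite tl_UE // tl_single_comp; apply/ffunP => t.
rewrite (@tangle_compE _ _ _ _ (act i) (has_cup i)) ?ffunE //.
- by move=> t2 t'; case: (stack_u (inordS i_n) t2 t').
- by move=> t2; case: (stack_u (inordS i_n) t2 t2).
Qed.

(** Both equations say that the same weighted sums vanish, over the fibres of capping on one side
    and of surgery on the other; these fibres coincide. *)
Lemma tl_comp_cap_eq0 i x : (i < n)%N ->
  tl_comp q (tl_cap R N i) x = 0 <-> U i x = 0.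
Proof.
move=> i_n; pose f := tl_cap_off (inordS i_n).
have capE t : tl_comp q (tl_cap R N i) x t =
    \sum_(s | f s == t) x s * delta ^+ has_cup i s.
  rewrite (tl_capE i_n) tl_single_comp (@tangle_compE _ _ _ _ f (has_cup i)) //.
  - by move=> t2 t'; case: (stack_cap (inordS i_n) t2 t').
  - by move=> t2; case: (stack_cap (inordS i_n) t2 (f t2)).
have fE s s' : (f s == f s') = (act i s == act i s').
  apply/eqP/eqP => [/tl_cap_off_inj //|E]; apply: tangle_ext => y.
  by apply: (skip_pt_inj (ab := inordS i_n)); rewrite /f !tl_cap_offE;
    move: E; rewrite /act => ->.
split=> /ffunP E; apply/ffunP => t; rewrite ?capE [RHS]ffunE.
  rewrite ffunE; have [s0 /eqP <-|none] := pickP (fun s => act i s == t).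
    have := E (f s0); rewrite capE [RHS]ffunE => E0; apply: etrans E0.
    by apply: eq_bigl => s; rewrite fE.
  by rewrite big_pred0.
have [s0 /eqP <-|none] := pickP (fun s => f s == t); last by rewrite big_pred0.
have := E (act i s0); rewrite [RHS]ffunE ffunE => E0; apply: etrans E0.
by apply: eq_bigl => s; rewrite fE.
Qed.

(** This is the instance of associativity that is needed, for t1 u_i = delta t1. *)
Lemma tangle_comp_U m i (t1 : tangle N m) x : (i < n)%N ->
  t1 (inl (inord i)) = inl (inord i.+1) ->
  tangle_comp t1 (U i x) = delta *: tangle_comp t1 x.
Proof.
move=> i_n t1i; have ab := inordS i_n.
(* If s already has the cup, u_i fixes s and contributes the circle itself; otherwise the cup of u_i
   s closes up with the cap of [t1]. *)
have stE s t : is_stack t1 (act i s) t = is_stack t1 s t /\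
    (has_cup i s + closed_circles t1 (act i s))%N = (closed_circles t1 s).+1.
  have [ci|nci] := boolP (has_cup i s).
    by rewrite (tla_id (tangle_tl_action n)).
  by rewrite (reconnect_is_stack ab t1i nci) (reconnect_closed_circles ab t1i
    nci).
apply/ffunP => t; rewrite !ffunE scaler_sumr.
under eq_bigr => s _ do rewrite ffunE big_distrl /=.
rewrite (exchange_big_dep (fun s => is_stack t1 s t)) /= => [|s r st /eqP E];
  last first.
  by rewrite -(stE r t).1 E.
apply: eq_bigr => s st; rewrite (big_pred1 (act i s)) => [|r /=]; last first.
  rewrite andbC [r == _]eq_sym; case: eqP => //= <-; by rewrite (stE s t).1.
by rewrite -mulrA -exprD (stE s t).2 exprS mulrCA.
Qed.

Lemma tangle_comp_kernel m x (t1 : tangle N m) : delta != 0 ->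
  (forall i, (i < n)%N -> U i x = 0) ->
  (exists2 i, (i < n)%N & t1 (inl (inord i)) = inl (inord i.+1)) ->
  tangle_comp t1 x = 0.
Proof.
move=> d0 Ux [i i_n t1i]; have := tangle_comp_U x i_n t1i.
rewrite Ux // => /esym/eqP; rewrite (_ : tangle_comp t1 0 = 0).
  by rewrite scaler_eq0 (negPf d0) => /eqP.
by apply/ffunP => t; rewrite !ffunE big1 // => s _; rewrite ffunE mul0r.
Qed.

(** Every tangle of [y] other than the identity has an innermost bottom arc and so annihilates
    [x]. *)
Lemma tl_comp_kernel x y : delta != 0 -> (forall i, (i < n)%N -> U i x = 0) ->
  tl_comp q y x = y (id_tangle N) *: x.
Proof.
move=> d0 Ux; rewrite tl_compE (bigD1 (id_tangle N)) //= tangle_comp_id.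
rewrite big1 ?addr0 // => t;
  rewrite -is_idE => /not_id_bottom_arc[a [b [ab tab]]].
rewrite (tangle_comp_kernel d0 Ux) ?scaler0 //.
have i_n : (a < n)%N by have := ltn_ord b; lia.
by exists a => //; rewrite -ab !inord_val.
Qed.

(** Once the U_i kill x, the product x x is x times its identity coefficient, so a nonzero x is
    idempotent exactly when that coefficient is 1. *)
Lemma is_jones_wenzlE x : delta != 0 ->
  is_jones_wenzl q x <->
  x (id_tangle N) = 1 /\ forall i, (i < n)%N -> U i x = 0.
Proof.
move=> d0; split=> [[x0 xx capx]|[x1 Ux]].
  have Ux i : (i < n)%N -> U i x = 0.
    by move=> i_n; apply/tl_comp_cap_eq0 => //; apply: capx.
  split=> //; move: xx; rewrite tl_comp_kernel // => /eqP.
  rewrite -[X in _ == X]scale1r -subr_eq0 -scalerBl scaler_eq0 (negPf x0) orbF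
    subr_eq0.
  by move=> /eqP.
split.
- by apply/eqP => x0; move: x1; rewrite x0 ffunE => /eqP;
  rewrite eq_sym oner_eq0.
- by rewrite tl_comp_kernel // x1 scale1r.
- by move=> i i_n; apply/tl_comp_cap_eq0 => //; apply: Ux.
Qed.
End Strands.
End TLComposition.


(** * Normalized torus braids as powers of C *)

Section Braids.
Variables (R : fieldType) (s : R) (n : nat).
Hypothesis s0 : s != 0.
Local Notation N := n.+1.
Local Notation A := (Aop (act (n := n)) (has_cup (n := n)) (s ^+ 2)).
Local Notation Aw := (Aword (act (n := n)) (has_cup (n := n)) (s ^+ 2)).

Lemma tl_comp_linear_l (q : R) k l m (y : TL R k l) :
  linear (fun x : TL R l m => tl_comp q x y).
Proof.
move=> a x x'; rewrite !tl_compE scaler_sumr -big_split; apply: eq_bigr => t _.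
by rewrite !ffunE scalerDl scalerA.
Qed.

Lemma tl_comp_bracket_gen i (x : TL R N N) : (i < n)%N ->
  s *: tl_comp (s ^+ 2) (bracket_gen s N i) x = A i x.
Proof.
move=> i_n; rewrite /bracket_gen tl_comp_linear_l.
(* The zero gives the second summand the shape [a *: x + x'] on which linearity rewrites. *)
rewrite -[_ *: tl_id R N]addr0 tl_comp_linear_l tl_comp_U //.
rewrite tl_idE tl_single_comp tangle_comp_id.
rewrite (_ : tl_comp _ 0 x = 0); last first.
  by apply/ffunP => t; rewrite tl_compE big1 // => u _; rewrite ffunE scale0r.
by rewrite addr0 scalerDr !scalerA mulfV // scale1r addrC.
Qed.

(** One factor s per crossing, since s (s U_i + s^-1) = 1 + s^2 U_i. *)
Lemma bracketE w : {in w, forall i, (i < n)%N} ->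
  s ^+ size w *: bracket s N w = Aw w (tl_id R N).
Proof.
elim: w => [|i w IH] wn /=; first by rewrite scale1r.
have wn' : {in w, forall j, (j < n)%N} by move=> j jw;
  rewrite wn // inE jw orbT.
rewrite -IH // -tl_comp_bracket_gen ?wn ?mem_head // exprS -scalerA;
  congr (_ *: _).
set x := bracket _ _ _; set y := bracket_gen _ _ _.
rewrite !tl_compE scaler_sumr; apply: eq_bigr => t _.
rewrite !scalerA mulrC -scalerA; congr (_ *: _).
apply/ffunP => u; rewrite !ffunE scaler_sumr; apply: eq_bigr => v _.
by rewrite ffunE -scalerAl.
Qed.

Lemma size_torus_braid m : size (torus_braid m N) = (m * N * (N - 1))%N.
Proof.
rewrite size_flatten /shape map_nseq size_iota; elim: (m * N)%N => //= k ->.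
by rewrite mulSn.
Qed.

Lemma bracket_torus_braid m :
  s ^+ (m * N * (N - 1)) *: bracket s N (torus_braid m N) =
  iter (m * N) (Cop n (act (n := n)) (has_cup (n := n)) (s ^+ 2)) (tl_id R N).
Proof.
rewrite -size_torus_braid bracketE.
  rewrite /torus_braid subn1 /=; elim: (m * N)%N => //= k IH.
  by rewrite Aword_cat IH.
by move=> i /flattenP[w]; rewrite mem_nseq => /andP[_ /eqP->];
  rewrite mem_iota subn1.
Qed.
End Braids.

(** * Expansion of rational functions *)

Section Constants.
Variable F : fieldType.

Fact lconst_bounded (a : F) :
  exists N : int, forall j, j < N -> (if j == 0 then a else 0) = 0.
Proof. by exists 0 => j j0; rewrite lt_eqF. Qed.
(** [levalE] replaces [ratr] by this morphism, whose coefficients are explicit. *)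
Definition lconst (a : F) : laurent_field F := MkLaurent (lconst_bounded a).

Lemma lconstM a (f : laurent F) j : (lconst a * f) j = a * f j.
Proof.
have [N fN] := lcoef_bounded f.
rewrite [LHS](_ : _ = lmul (lconst a) f j) //.
rewrite (@lmulE _ _ f 0 N j 0 (`|(j - N)%R|%N).+1) //; last 2 first.
- by move=> i i0 /=; rewrite lt_eqF.
- lia.
rewrite big_ord_recl /= big1 => [|i _]; first by rewrite !subr0 addr0.
by rewrite /= mul0r.
Qed.

Fact lconst_zmod_morphism : zmod_morphism lconst.
Proof.
by move=> a b; apply: laurentP => j /=; case: eqP; rewrite ?subr0.
Qed.
HB.instance Definition _ :=
  GRing.isZmodMorphism.Build F (laurent_field F) lconst lconst_zmod_morphism.

Fact lconst_monoid_morphism : monoid_morphism lconst.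
Proof.
split=> [|a b]; first by apply: laurentP => j /=; case: eqP.
apply: laurentP => j; rewrite lconstM /=; case: eqP => //.
by rewrite mulr0.
Qed.
HB.instance Definition _ :=
  GRing.isMonoidMorphism.Build F (laurent_field F) lconst
    lconst_monoid_morphism.
End Constants.

Lemma subf_div (K : fieldType) (a b c d : K) : b != 0 -> d != 0 ->
  a / b - c / d = (a * d - c * b) / (b * d).
Proof. by move=> b0 d0; rewrite -!mulNr addf_div. Qed.

Lemma mulrBMM (K : comNzRingType) (x y b d : K) :
  (x - y) * (b * d) = x * b * d - y * d * b.
Proof. by ring. Qed.

Section Expansion.
Definition leval (p : {poly rat}) : lseries :=
  (map_poly (ratr : rat -> lseries) p).[qhalf ^+ 2].

Lemma levalE p : leval p = (map_poly (@lconst rat) p).[qhalf ^+ 2].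
Proof.
rewrite /leval; congr (_.[_]); apply: eq_map_poly => a.
by rewrite -(fmorph_eq_rat (@lconst rat)).
Qed.

Fact leval_zmod_morphism : zmod_morphism leval.
Proof. by move=> p p'; rewrite !levalE rmorphB hornerD hornerN. Qed.
HB.instance Definition _ :=
  GRing.isZmodMorphism.Build {poly rat} lseries leval leval_zmod_morphism.

Fact leval_monoid_morphism : monoid_morphism leval.
Proof.
split=> [|p p']; first by rewrite levalE rmorph1 hornerC.
by rewrite !levalE rmorphM hornerM.
Qed.
HB.instance Definition _ :=
  GRing.isMonoidMorphism.Build {poly rat} lseries leval leval_monoid_morphism.

Lemma qhalf_sqr : qhalf ^+ 2 = lmonom rat 2.
Proof. exact: lmonomX. Qed.

(** X goes to q, which has index 2. The coefficients of p can thus be read off, which makes [leval]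
    injective and keeps denominators nonzero. *)
Lemma lcoef_leval p (k : nat) : lcoef (leval p) (2 * k%:Z) = p`_k.
Proof.
rewrite levalE /map_poly horner_poly.
have sumE (I : finType) (f : I -> lseries) j :
    lcoef (\sum_i f i) j = \sum_i lcoef (f i) j.
  by elim/big_rec2: _ => // i y1 y2 _ <-.
rewrite sumE.
under eq_bigr => i _ do rewrite lconstM qhalf_sqr lmonomX /=.
have [kp|kp] := ltnP k (size p).
  rewrite (bigD1 (Ordinal kp)) //= eqxx mulr1 big1 ?addr0 // => i ik.
  have -> : (2 * k%:Z == 2 * i%:Z) = false; last by rewrite mulr0.
  apply/eqP => /(mulfI (isT : 2 != 0 :> int))-[ki].
  by case/eqP: ik; apply: val_inj.
rewrite nth_default // big1 // => i _.
have -> : (2 * k%:Z == 2 * i%:Z) = false; last by rewrite mulr0.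
apply/eqP => /(mulfI (isT : 2 != 0 :> int))-[ki].
by move: kp; rewrite ki leqNgt ltn_ord.
Qed.

Lemma leval_eq0 p : (leval p == 0) = (p == 0).
Proof.
apply/eqP/eqP => [p0|->]; last exact: rmorph0.
by apply/polyP => k; rewrite -lcoef_leval p0 coef0.
Qed.

Lemma ratfun_repr (x : ratfun) :
  x * tofrac (frac (repr x)).2 = tofrac (frac (repr x)).1.
Proof.
rewrite -[x in x * _]reprK; move: (repr x) => r.
unlock tofrac; rewrite -[LHS]FracField.pi_mul; apply/eqmodP => /=.
rewrite FracField.equivfE /FracField.mulf !numden_Ratio ?mulf_neq0
  ?denom_ratioP ?oner_neq0 //.
by rewrite !mulr1 mulrC.
Qed.

(** Independence of the chosen representative: any fraction equal to x may be used to compute its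
    expansion. *)
Lemma lexpandP (x : ratfun) (a b : {poly rat}) : b != 0 ->
  x * tofrac b = tofrac a -> lexpand x = leval a / leval b.
Proof.
move=> b0 xba; rewrite /lexpand -!/(leval _).
have := ratfun_repr x; have := denom_ratioP (repr x).
move: (frac (repr x)) => -[a' b'] /= b'0 xba'.
apply/eqP; rewrite eqr_div ?leval_eq0 // -!rmorphM; apply/eqP; congr leval.
apply/eqP; rewrite -tofrac_eq !tofracM -xba -xba' mulrAC //.
Qed.

Fact lexpand_zmod_morphism : zmod_morphism lexpand.
Proof.
move=> x y; have := ratfun_repr x; have := ratfun_repr y.
have := denom_ratioP (repr x); have := denom_ratioP (repr y).
move: (frac (repr x)) (frac (repr y)) => -[a b] [c d] /= d0 b0 yE xE.
rewrite (@lexpandP _ (a * d - c * b) (b * d)) ?mulf_neq0 //; last first.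
  by rewrite tofracB !tofracM -xE -yE; exact: mulrBMM.
rewrite (lexpandP b0 xE) (lexpandP d0 yE) rmorphB !rmorphM.
have lb : leval b != 0 by rewrite leval_eq0.
have ld : leval d != 0 by rewrite leval_eq0.
exact/esym/(subf_div _ _ lb ld).
Qed.
HB.instance Definition _ :=
  GRing.isZmodMorphism.Build ratfun lseries lexpand lexpand_zmod_morphism.

Fact lexpand_monoid_morphism : monoid_morphism lexpand.
Proof.
split=> [|x y].
  by rewrite (@lexpandP 1 1 1) ?oner_eq0 ?mulr1 ?rmorph1 ?divr1.
have := ratfun_repr x; have := ratfun_repr y.
have := denom_ratioP (repr x); have := denom_ratioP (repr y).
move: (frac (repr x)) (frac (repr y)) => -[a b] [c d] /= d0 b0 yE xE.
rewrite (@lexpandP _ (a * c) (b * d)) ?mulf_neq0 //; last first.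
  by rewrite !tofracM -xE -yE; exact: mulrACA.
by rewrite (lexpandP b0 xE) (lexpandP d0 yE) !rmorphM mulf_div.
Qed.
HB.instance Definition _ :=
  GRing.isMonoidMorphism.Build ratfun lseries lexpand lexpand_monoid_morphism.

Lemma lexpand_q : lexpand ratfun_q = qhalf ^+ 2.
Proof.
rewrite (@lexpandP _ 'X 1) ?oner_eq0 ?rmorph1 ?mulr1 // divr1.
by rewrite levalE map_polyX hornerX.
Qed.
End Expansion.

(** * Orders as suprema, the projector over Q(q), and the limit *)

Lemma le_supremum_EFin (A : set int) (M : int) : A M ->
  (M%:E <= supremum -oo [set m%:E | m in A])%E.
Proof.
move=> AM; set S := [set _ | _ in _]%classic.
have SM : S M%:E by exists M.
rewrite /supremum; case: ifPn => [/eqP S0|_]; first by move: SM; rewrite S0.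
(* [supremum] selects a least upper bound by choice, so one must be exhibited: the maximum of a
   bounded set of integers, and +oo for an unbounded one. *)
suff [s sP] : exists s, supremums S s by case: xgetP =>
  [y _ [ub _]|/(_ s)//]; apply: ub.
have [[B AB]|unbounded] := pselect (exists B : int, forall m, A m -> m <= B).
  (* Shifting by the known member M turns the search for the maximum into one over natural
     numbers. *)
  pose P (k : nat) := `[< A (M + k%:Z) >].
  have exP : exists k, P k by exists 0%N; apply/asboolP; rewrite addr0.
  have bP k : P k -> (k <= `|(B - M)%R|)%N by move=> /asboolP/AB; lia.
  have [k /asboolP Ak maxk] := ex_maxnP exP bP.
  exists (M + k%:Z)%:E; split=> [_ [m Am <-]|u]; last by apply;
    exists (M + k%:Z).
  rewrite lee_fin; have [mM|Mm] := leP m M; first lia.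
  have := maxk `|(m - M)%R|%N; rewrite /P (_ : M + _ = m); last lia.
  by move=> /(_ (asboolT Am)); lia.
exists +oo%E; split=> [? _|u ub]; first exact: leey.
case: u ub => [r|//|] ub; last by have := ub _ SM.
case: unbounded; exists r => m Am; rewrite -lee_fin; apply: ub; by exists m.
Qed.

Lemma ratfun_q_neq0 : ratfun_q != 0.
Proof. by rewrite tofrac_eq0 polyX_eq0. Qed.

Lemma ratfun_delta_neq0 : - (ratfun_q + ratfun_q^-1) != 0.
Proof.
have E : ratfun_q * (ratfun_q + ratfun_q^-1) = tofrac ('X^2 + 1%:P).
  by rewrite mulrDr mulfV ?ratfun_q_neq0 // tofracD tofrac1 tofracXn.
rewrite oppr_eq0; apply/eqP => q0; move: E; rewrite q0 mulr0 => /esym/eqP.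
rewrite tofrac_eq0 -size_poly_eq0 size_polyDl ?size_polyXn //.
by rewrite size_polyC oner_eq0.
Qed.

Lemma qhalf_neq0 : qhalf != 0.
Proof.
apply/eqP => /(congr1 (fun f : lseries => lcoef f 1)) /=.
by apply/eqP; rewrite oner_eq0.
Qed.

Section JonesWenzl.
Variable n : nat.
Local Notation N := n.+1.
Local Notation e := (act (n := n)).
Local Notation c := (has_cup (n := n)).

Let tla := tangle_tl_action n.

Lemma order_lexpand_q : order_ge 1 (lexpand ratfun_q).
Proof.
rewrite lexpand_q qhalf_sqr; apply: (@order_ge_trans _ 2) => //.
exact: order_ge_monom.
Qed.

Lemma jones_wenzl_unique : exists P, unique (is_jones_wenzl ratfun_q (n :=
  N)) P.
Proof.
have d0 := ratfun_delta_neq0; have q0 := ratfun_q_neq0.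
have [P [P1 PU]] := common_kernel_exists tla (phi :=
  lexpand) q0 order_lexpand_q.
exists P; split; first by apply/(is_jones_wenzlE _ d0).
move=> P' /(is_jones_wenzlE _ d0)[P'1 P'U]; apply/eqP; rewrite -subr_eq0;
  apply/eqP.
apply: (common_kernel_eq0 tla (phi := lexpand) q0 order_lexpand_q) => [i i_n|].
  by rewrite linearB /= PU // P'U // subrr.
by rewrite !ffunE P1 P'1 subrr.
Qed.

Lemma jones_wenzlP :
  jones_wenzl N (id_tangle N) = 1 /\
  forall i, (i < n)%N -> Uop e c ratfun_q i (jones_wenzl N) = 0.
Proof.
apply/(is_jones_wenzlE _ ratfun_delta_neq0); rewrite /jones_wenzl.
have [P PU] := jones_wenzl_unique.
by case: xgetP => [Q _ []|/(_ P)].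
Qed.

Lemma tl_expand_jones_wenzlP :
  tl_expand (jones_wenzl N) (id_tangle N) = 1 /\
  forall i, (i < n)%N -> Uop e c (qhalf ^+ 2) i (tl_expand (jones_wenzl N)) = 0.
Proof.
have [P1 PU] := jones_wenzlP; split=> [|i i_n];
  first by rewrite ffunE P1 rmorph1.
rewrite -lexpand_q.
have := Uop_vmap e c ratfun_q lexpand i (jones_wenzl N).
rewrite PU // => E; apply: etrans E _.
by apply/ffunP => t; rewrite !ffunE rmorph0.
Qed.
End JonesWenzl.

Theorem theorem2p2 (n : nat) (hn : (1 <= n)%N) :
  tl_converges
    (fun m : nat =>
       qhalf ^+ (m * n * (n - 1)) *: bracket qhalf n (torus_braid m n))
    (tl_expand (jones_wenzl n)).
Proof.
case: n hn => // n _; have tla := tangle_tl_action n.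
have [P1 PU] := tl_expand_jones_wenzlP n; set P := tl_expand _ in P1 PU *.
have q0 : qhalf ^+ 2 != 0 by rewrite expf_neq0 ?qhalf_neq0.
have q1 : order_ge 1 (qhalf ^+ 2) by rewrite -lexpand_q; exact: order_lexpand_q.
pose C := Cop n (act (n := n)) (has_cup (n := n)) (qhalf ^+ 2).
have CP k : iter k C P = P by elim: k => //= k ->; exact: Cop_fixed.
pose y := P - tl_id lseries n.+1.
have yo : y (id_tangle n.+1) = 0.
  transitivity (P (id_tangle n.+1) - tl_id lseries n.+1 (id_tangle n.+1)).
    by rewrite !ffunE.
  by rewrite P1 ffunE -/(is_id _) is_idE eqxx subrr.
have [K yK] := @vorder_ge_exists _ rat y.
(* C^(m(n+1)) raises the order K of y by m(n+1), which is at least m. The target is 2M because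
   indices count powers of q^(1/2). *)
move=> M; exists `|(2 * M - K)%R|%N => // m /= Km.
apply: le_supremum_EFin => t j jM.
(* As C fixes P, the error is C^(m(n+1)) applied to y = P - 1, which has no identity component and
   is therefore contracted. *)
have -> : P - qhalf ^+ (m * n.+1 * (n.+1 - 1)) *: bracket qhalf n.+1
  (torus_braid m n.+1)
   = iter (m * n.+1) C y.
  by rewrite bracket_torus_braid ?qhalf_neq0 // iter_CopB CP.
have H := @iter_Cop_order _ _ _ _ _ tla _ _ q0 q1 _ (m * n.+1) _ yK yo.
apply: (H t j).
nia.
Qed.
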